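(* Let $\mu$ be a probability measure on $\mathbb R$ for which there is $c>0$ such that $\left|\int x^l\,d\mu(x)\right|\le(cl)^l$ for all $l\ge0$, and let $(x_{N,n})_{N\ge1,1\le n\le N}\subset\mathbb R$ with $x_{N,n-1}\ge x_{N,n}$ for $2\le n\le N$ be such that the empirical measures $$\mu_{N,0}:=\frac1N\bigl(\delta_{x_{N,1}/\sqrt N}+\dots+\delta_{x_{N,N}/\sqrt N}\bigr)$$ tend weakly to $\mu$ for $N\to\infty$. Let $(\phi_{N,1}(t),\dots,\phi_{N,N}(t))$ be the solution of $$\frac{d}{dt}x_i(t)=\sum_{j\ne i}\frac1{x_i(t)-x_j(t)}\qquad(i=1,\dots,N)$$ with start in $(x_{N,1},\dots,x_{N,N})$, and let $$\mu_{N,t}:=\frac1N\bigl(\delta_{\phi_{N,1}(t)/\sqrt N}+\dots+\delta_{\phi_{N,N}(t)/\sqrt N}\bigr)\qquad(t\ge0).$$ Then for $t\in[0,\infty[$ the $\mu_{N,t}$ tend weakly to $\mu_{sc,2\sqrt t}\boxplus\mu$ for $N\to\infty$.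
   Context: $C_N^A:=\{x\in\mathbb R^N: x_1\ge\dots\ge x_N\}$. For every starting point $x_0\in C_N^A$ (including boundary points) the ODE has a unique solution in the following sense: a continuous map $[0,\infty[\to C_N^A$ with $x(0)=x_0$ such that for $t>0$ the point $x(t)$ lies in the interior of $C_N^A$ and the ODE holds. $\mu_{sc,R}$ is the semicircle law with density $\frac{2}{\pi R^2}\sqrt{R^2-x^2}$ on $[-R,R]$ for $R>0$, and $\mu_{sc,0}=\delta_0$. $\boxplus$ is the free additive convolution. In the moment condition $(cl)^l:=1$ for $l=0$. *)

(* Defs.v *)
From HB Require Import structures.
From mathcomp Require Import all_boot all_order all_algebra.
From mathcomp Require Import all_classical all_reals all_analysis.
From mathcomp Require Import measurable_realfun complex ring lra.

Set Implicit Arguments.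
Unset Strict Implicit.
Unset Printing Implicit Defensive.

Import Order.TTheory GRing.Theory Num.Theory.
Import numFieldNormedType.Exports.

Local Open Scope classical_set_scope.
Local Open Scope ring_scope.
Local Open Scope complex_scope.

Notation probR R := (probability (measurableTypeR R) R).

Definition weakly_cvg (R : realType) (mu_ : nat -> probR R) (mu : probR R) :=
  forall f : R -> R, continuous f -> (exists M, forall x, `|f x| <= M) ->
    (\int[mu_ n]_x f x)%R @[n --> \oo] --> (\int[mu]_x f x)%R.

Definition empirical (R : realType) (n : nat) (y : 'rV[R]_n.+1) :
    set (measurableTypeR R) -> \bar R :=
  fun A => ((n.+1%:R^-1)%:E * \sum_(i < n.+1) \d_(y ord0 i) A)%E.

Section empirical_probability.
Context (R : realType) (n : nat) (y : 'rV[R]_n.+1).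

Let empirical0 : empirical y set0 = 0%E.
Proof. by rewrite /empirical big1 ?mule0// => i _; rewrite measure0. Qed.

Let empirical_ge0 A : (0 <= empirical y A)%E.
Proof.
by rewrite /empirical mule_ge0 ?sume_ge0// => [|i _]; rewrite lee_fin invr_ge0.
Qed.

Let empirical_sigma_additive : semi_sigma_additive (empirical y).
Proof.
move=> F mF tF mUF; rewrite /empirical.
rewrite [X in X @ _ --> _](_ : _ = fun k => ((n.+1%:R^-1)%:E *
   \sum_(i < n.+1) \sum_(0 <= j < k) \d_(y ord0 i) (F j))%E); last first.
  apply/funext => k; rewrite exchange_big/= ge0_sume_distrr// => j _.
  exact: sume_ge0.
apply: cvgeZl => //.
apply: (@cvg_nnesum _ _ _ _ _ _
  (fun i k => \sum_(0 <= j < k) \d_(y ord0 i) (F j))%E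
  (fun i => \d_(y ord0 i) (\bigcup_k F k))) => i _.
- by apply: nearW => k; exact: sume_ge0.
- exact: measure_semi_sigma_additive.
Qed.

HB.instance Definition _ := isMeasure.Build _ _ _ (empirical y)
  empirical0 empirical_ge0 empirical_sigma_additive.

Let empirical_setT : empirical y setT = 1%E.
Proof.
rewrite /empirical (eq_bigr (fun=> 1%E)) => [|i _]; last by rewrite diracT.
by rewrite sumEFin sumr_const card_ord -EFinM mulVf// pnatr_eq0.
Qed.

HB.instance Definition _ :=
  @Measure_isProbability.Build _ _ R (empirical y) empirical_setT.

End empirical_probability.

Definition semicircle_pdf (R : realType) (r x : R) : R :=
  if `|x| <= r then 2 / (pi * r ^+ 2) * Num.sqrt (r ^+ 2 - x ^+ 2) else 0.

Section semicircle_pdf.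
Context {R : realType}.
Local Notation mu := (@lebesgue_measure R).

Lemma semicircle_pdf_ge0 (r x : R) : 0 <= semicircle_pdf r x.
Proof.
rewrite /semicircle_pdf; case: ifP => // _.
by rewrite mulr_ge0// ?sqrtr_ge0// divr_ge0// mulr_ge0 ?sqr_ge0// pi_ge0.
Qed.

Lemma continuous_semicircle_sqrt (r : R) :
  continuous (fun x : R => 2 / (pi * r ^+ 2) * Num.sqrt (r ^+ 2 - x ^+ 2)).
Proof.
move=> x; apply: cvgM; first exact: cvg_cst.
apply: (@continuous_comp _ _ _ (fun x : R => r ^+ 2 - x ^+ 2) Num.sqrt).
  by apply: cvgB; [exact: cvg_cst|exact: exprn_continuous].
exact: sqrt_continuous.
Qed.

Lemma measurable_semicircle_pdf (r : R) : measurable_fun setT (semicircle_pdf r).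
Proof.
apply: measurable_fun_if => //.
- by apply: measurable_fun_ler => //; exact: measurableT_comp.
- apply: measurable_funTS; apply: continuous_measurable_fun.
  exact: continuous_semicircle_sqrt.
Qed.

Lemma integral_cos2 :
  (\int[mu]_(x in `[(- (pi / 2))%R, (pi / 2)%R]) (cos x ^+ 2)%:E = (pi / 2)%:E)%E.
Proof.
pose F (x : R) := (x + sin x * cos x) / 2.
have dF (x : R) : is_derive x 1 F (cos x ^+ 2).
  apply: is_derive_eq.
  rewrite /GRing.scale/=; have := cos2Dsin2 x; lra.
have cF : continuous F.
  move=> x; apply: differentiable_continuous.
  by apply/derivable1_diffP; have [] := dF x.
rewrite (@continuous_FTC2 _ _ F).
- rewrite /F !cosN !sinN cos_pihalf; congr EFin; lra.
- by rewrite -subr_gt0 opprK addr_gt0// divr_gt0// pi_gt0.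
- apply: continuous_subspaceT => x; apply: (@continuous_comp _ _ _ cos (fun y => y ^+ 2)).
    exact: continuous_cos.
  exact: exprn_continuous.
- split=> [x _||].
  + by have [] := dF x.
  + exact/cvg_at_right_filter/cF.
  + exact/cvg_at_left_filter/cF.
- by move=> x _; rewrite derive1E; apply: derive_val.
Qed.

Lemma integral_semicircle_pdf (r : R) : 0 < r ->
  (\int[mu]_x (semicircle_pdf r x)%:E = 1)%E.
Proof.
move=> r0.
transitivity (\int[mu]_(x in `[(r * sin (- (pi / 2)))%R, (r * sin (pi / 2))%R])
    (2 / (pi * r ^+ 2) * Num.sqrt (r ^+ 2 - x ^+ 2))%:E)%E.
  rewrite sinN sin_pihalf mulrN mulr1 [RHS]integral_mkcond/=.
  apply: eq_integral => x _; rewrite patchE /semicircle_pdf ler_norml.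
  by case: ifPn; rewrite mem_setE in_itv/=; case: ifP.
have dF (x : R) : is_derive x 1 (fun x => r * sin x) (r * cos x).
  apply: is_derive_eq; rewrite /GRing.scale/=; lra.
have F'E : derive1 (fun x : R => r * sin x) = (fun x => r * cos x).
  by apply/funext => x; rewrite derive1E; apply: derive_val.
have cF' : continuous (fun x : R => r * cos x).
  by move=> x; apply: cvgM; [exact: cvg_cst|exact: continuous_cos].
have cF : continuous (fun x : R => r * sin x).
  by move=> x; apply: cvgM; [exact: cvg_cst|exact: continuous_sin].
have pi0 : 0 < pi :> R := pi_gt0 R.
rewrite (@integration_by_substitution_increasing _ (fun x => r * sin x)
   (fun x => 2 / (pi * r ^+ 2) * Num.sqrt (r ^+ 2 - x ^+ 2))).
- transitivity (\int[mu]_(x in `[(- (pi / 2))%R, (pi / 2)%R])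
      ((2 / pi)%:E * (cos x ^+ 2)%:E))%E.
    apply: eq_integral => x; rewrite inE/= in_itv/= => xpi.
    rewrite F'E -EFinM; congr EFin; rewrite fctE/=.
    have c0 : 0 <= cos x by apply: cos_ge0_pihalf.
    rewrite (_ : r ^+ 2 - _ = (r * cos x) ^+ 2); last first.
      rewrite !exprMn; have := cos2Dsin2 x; nra.
    rewrite sqrtr_sqr ger0_norm ?mulr_ge0// ?ltW//.
    clear -r0 pi0; move: pi pi0 => p p0; field; rewrite ?gt_eqF//.
  rewrite ge0_integralZl//=.
  + rewrite integral_cos2 -EFinM; congr EFin.
    clear -pi0; move: pi pi0 => p p0; field; rewrite ?gt_eqF//.
  + apply/measurable_EFinP; apply: measurable_funTS.
    apply: continuous_measurable_fun => x.
    apply: (@continuous_comp _ _ _ cos (fun y => y ^+ 2)).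
      exact: continuous_cos.
    exact: exprn_continuous.
  + by move=> x _; rewrite lee_fin sqr_ge0.
  + by rewrite lee_fin divr_ge0// ltW.
- by rewrite -subr_ge0 opprK addr_ge0// divr_ge0// ltW.
- by move=> x y xI yI xy; rewrite ltr_pM2l// ltr_sin.
- by rewrite F'E => x _; exact: cF'.
- by rewrite F'E; apply/cvg_ex; eexists; exact/cvg_at_right_filter/cF'.
- by rewrite F'E; apply/cvg_ex; eexists; exact/cvg_at_left_filter/cF'.
- split=> [x _||].
  + by have [] := dF x.
  + exact/cvg_at_right_filter/cF.
  + exact/cvg_at_left_filter/cF.
- apply: continuous_subspaceT; exact: continuous_semicircle_sqrt.
Qed.

End semicircle_pdf.

(* The semicircle law of radius r, with the convention that it is the Dirac
   mass at 0 for r = 0; the value for r < 0 is irrelevant. *)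
Definition semicircle (R : realType) (r : R) :
    set (measurableTypeR R) -> \bar R :=
  fun A => if 0 < r then (\int[lebesgue_measure]_(x in A) (semicircle_pdf r x)%:E)%E
           else \d_(0 : R) A.

Section semicircle_probability.
Context (R : realType) (r : R).

Let semicircle0 : semicircle r set0 = 0%E.
Proof. by rewrite /semicircle; case: ifP; rewrite ?integral_set0 ?measure0. Qed.

Let semicircle_ge0 A : (0 <= semicircle r A)%E.
Proof.
rewrite /semicircle; case: ifP => // _; apply: integral_ge0 => x _.
by rewrite lee_fin semicircle_pdf_ge0.
Qed.

Let semicircle_sigma_additive : semi_sigma_additive (semicircle r).
Proof.
move=> /= F mF tF mUF; rewrite /semicircle; case: ifP => r0; last first.
  exact: measure_semi_sigma_additive.
apply: cvg_toP.
  apply: ereal_nondecreasing_is_cvgn => m n mn.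
  apply: lee_sum_nneg_natr => // k _ _.
  by apply: integral_ge0 => x _; rewrite lee_fin semicircle_pdf_ge0.
rewrite ge0_integral_bigcup//=.
- apply: measurable_funTS; apply: measurableT_comp => //.
  exact: measurable_semicircle_pdf.
- by move=> x _; rewrite lee_fin semicircle_pdf_ge0.
Qed.

HB.instance Definition _ := isMeasure.Build _ _ _ (semicircle r)
  semicircle0 semicircle_ge0 semicircle_sigma_additive.

Let semicircle_setT : semicircle r setT = 1%E.
Proof.
rewrite /semicircle; case: ifP => [|_]; first exact: integral_semicircle_pdf.
by rewrite diracT.
Qed.

HB.instance Definition _ :=
  @Measure_isProbability.Build _ _ R (semicircle r) semicircle_setT.

End semicircle_probability.

(* Componentwise integral of the complex-valued function x |-> 1 / (z - x). *)
Definition cauchy_transform (R : realType) (mu : probR R) (z : R[i]) : R[i] :=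
  (\int[mu]_x complex.Re (z - x%:C)^-1)%R +i*
  (\int[mu]_x complex.Im (z - x%:C)^-1)%R.

Definition recip_cauchy (R : realType) (mu : probR R) (z : R[i]) : R[i] :=
  (cauchy_transform mu z)^-1.

Definition stolz_cone (R : realType) (alpha beta : R) : set R[i] :=
  [set z | `|complex.Re z| < alpha * complex.Im z /\ beta < complex.Im z].

(* phi is the Voiculescu transform z |-> F^-1(z) - z of mu on the truncated cone
   Gamma_(alpha, beta), where F = 1 / G_mu (so that phi z = R_mu (1 / z) for the
   R-transform R_mu). The last clause selects, among the right inverses of F, the
   branch with F^-1(z) = z (1 + o(1)) at infinity in the cone, where F is
   injective. *)
Definition voiculescu_transform (R : realType) (mu : probR R) (alpha beta : R)
    (phi : R[i] -> R[i]) :=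
  (forall z, stolz_cone alpha beta z ->
     0 < complex.Im (z + phi z) /\ recip_cauchy mu (z + phi z) = z) /\
  (forall e : R, 0 < e -> exists M : R, forall z,
     stolz_cone alpha beta z -> M%:C < `|z| -> `|phi z| <= e%:C * `|z|).

Definition is_free_add_conv (R : realType) (mu nu rho : probR R) :=
  exists alpha beta : R, [/\ 0 < alpha, 0 < beta &
    exists phi psi : R[i] -> R[i],
      [/\ voiculescu_transform mu alpha beta phi,
          voiculescu_transform nu alpha beta psi &
          voiculescu_transform rho alpha beta (fun z => phi z + psi z)]].

(* By Bercovici and Voiculescu, the measure chosen by get exists and is unique
   for all probability measures mu and nu on the real line. *)
Definition free_add_conv (R : realType) (mu nu : probR R) : probR R :=
  get [set rho | is_free_add_conv mu nu rho].

Definition weyl_chamber (R : realType) (N : nat) : set 'rV[R]_N :=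
  [set x | forall i j : 'I_N, (i <= j)%N -> x ord0 j <= x ord0 i].
Arguments weyl_chamber : clear implicits.

Definition is_flow (R : realType) (N : nat) (x0 : 'rV[R]_N)
    (x : R -> 'rV[R]_N) :=
  [/\ {within `[0, +oo[, continuous x},
      forall t : R, 0 <= t -> weyl_chamber R N (x t),
      x 0 = x0 &
      forall t : R, 0 < t -> (weyl_chamber R N)° (x t) /\
        forall i, is_derive t 1 (fun s => x s ord0 i)
          (\sum_(j < N | j != i) (x t ord0 i - x t ord0 j)^-1)].

(* Main.v *)
Require Import Defs.
From HB Require Import structures.
From mathcomp Require Import all_boot all_order all_algebra.
From mathcomp Require Import all_classical all_reals all_analysis.
From mathcomp Require Import measurable_realfun complex ring lra.

Import Order.TTheory GRing.Theory Num.Theory.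
Import numFieldNormedType.Exports.
Local Open Scope classical_set_scope.
Local Open Scope ring_scope.
Local Open Scope complex_scope.

Set Implicit Arguments.
Unset Strict Implicit.
Unset Printing Implicit Defensive.

(** The proof follows the Cauchy transform G_N(s, z) of the rescaled particles. The
    interaction is pairwise and singular, but in each pair the singular factor
    cancels against the difference of two squared resolvents
    (interaction_resolvent), so that G_N solves the Burgers equation
    d_s G = - G d_z G with an error of order 1 / N. The characteristics of the
    inviscid equation are straight lines: with g = G_mu(w), the deviation
    A(s) = G_N(s, w + s g) - g satisfies a linear differential equation, whose
    coefficients are bounded because w + s g stays away from the real line. Its
    initial value tends to 0 by the assumption on the initial measures, and
    Gronwall's inequality (characteristic_bound) gives, without any compactness
    in time or in the space of paths,

      G_N(t, w + t G_mu(w)) --> G_mu(w)      for Im w >= 1 + t.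

    This limit implies that the measures at time t are tight
    (characteristics_tight). Along an ultrafilter on the indices they therefore
    converge weakly to a probability measure rho (ultra_prokhorov), and
    G_rho(w + t G_mu(w)) = G_mu(w). In terms of F = 1 / G, the right inverse of
    F_rho at z is the right inverse of F_mu at z plus t / z, and t / z is the
    Voiculescu transform of the semicircle law of radius 2 sqrt t
    (semicircle_cauchy). The right inverse of F_mu exists near infinity in a cone
    because mu has a finite first moment, which makes F_mu a contractive
    perturbation of the identity (recip_cauchy_surjective). So rho is a free
    additive convolution of the two laws (characteristics_free_add_conv); in
    particular such a measure exists.

    It is also unique (free_add_conv_unique). For another solution rho', the
    transforms of rho and rho' agree at points that accumulate and tend to infinity
    within a vertical strip. Power series expansions of the resolvent extend the
    agreement to the discs around these points that touch the real line
    (cauchy_transform_identity), which exhaust the upper half plane, and Stieltjes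
    inversion (distfun_cauchy_transform) recovers the measure. Hence all ultrafilter
    limits coincide with the free convolution, and the whole sequence converges. *)

(** * Complex moduli, complex-valued integrals and resolvents *)

Local Notation Re := complex.Re.
Local Notation Im := complex.Im.
Local Notation normc := ComplexField.Normc.normc.

Section modulus.
Context {R : realType}.
Implicit Types (z w : R[i]) (a b : R).

Lemma Re_addc z w : Re (z + w) = Re z + Re w. Proof. by case: z w => [a b] [c d]. Qed.
Lemma Im_addc z w : Im (z + w) = Im z + Im w. Proof. by case: z w => [a b] [c d]. Qed.
Lemma Re_oppc z : Re (- z) = - Re z. Proof. by case: z. Qed.
Lemma Im_oppc z : Im (- z) = - Im z. Proof. by case: z. Qed.
Lemma Re_mulc z w : Re (z * w) = Re z * Re w - Im z * Im w.
Proof. by case: z w => [a b] [c d]. Qed.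
Lemma Im_mulc z w : Im (z * w) = Re z * Im w + Im z * Re w.
Proof. by case: z w => [a b] [c d]. Qed.
Lemma Re_invc z : Re z^-1 = Re z / (Re z ^+ 2 + Im z ^+ 2). Proof. by case: z. Qed.
Lemma Im_invc z : Im z^-1 = - Im z / (Re z ^+ 2 + Im z ^+ 2).
Proof. by case: z => a b /=; rewrite mulNr. Qed.
Lemma Re_realc a : Re a%:C = a. Proof. by []. Qed.
Lemma Im_realc a : Im a%:C = 0. Proof. by []. Qed.
Definition ReImE := (Re_addc, Im_addc, Re_oppc, Im_oppc, Re_mulc, Im_mulc, Re_realc, Im_realc).

Lemma complex_ext z w : Re z = Re w -> Im z = Im w -> z = w.
Proof. by case: z w => [a b] [c d] /= -> ->. Qed.

Lemma Re_mulrc a z : Re (a%:C * z) = a * Re z.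
Proof. by rewrite Re_mulc/= mul0r subr0. Qed.
Lemma Im_mulrc a z : Im (a%:C * z) = a * Im z.
Proof. by rewrite Im_mulc/= mul0r addr0. Qed.

Lemma normc_sqrt z : normc z = Num.sqrt (Re z ^+ 2 + Im z ^+ 2).
Proof. by case: z. Qed.

Lemma normc_norm z : (normc z)%:C = `|z|. Proof. by []. Qed.

Lemma normc_sq z : normc z ^+ 2 = Re z ^+ 2 + Im z ^+ 2.
Proof. by rewrite normc_sqrt sqr_sqrtr// addr_ge0 ?sqr_ge0. Qed.

Lemma normc_ge0 z : 0 <= normc z. Proof. by rewrite normc_sqrt sqrtr_ge0. Qed.

Lemma normcM z w : normc (z * w) = normc z * normc w.
Proof. exact: ComplexField.Normc.normcM. Qed.

Lemma normcV z : normc z^-1 = (normc z)^-1.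
Proof. exact: ComplexField.Normc.normcV. Qed.

Lemma normc_opp z : normc (- z) = normc z.
Proof. by rewrite !normc_sqrt !ReImE !sqrrN. Qed.

Lemma normcD z w : normc (z + w) <= normc z + normc w.
Proof. exact: le_normcD. Qed.

Lemma normcB z w : normc (z - w) = normc (w - z).
Proof. by rewrite -normc_opp opprB. Qed.

Lemma normcX z n : normc (z ^+ n) = normc z ^+ n.
Proof.
by elim: n => [|n ih]; rewrite ?expr0 ?exprS ?normcM ?ih// ComplexField.Normc.normc1.
Qed.

Lemma normc0 : normc 0 = 0 :> R. Proof. exact: ComplexField.Normc.normc0. Qed.
Lemma normc1 : normc 1 = 1 :> R. Proof. exact: ComplexField.Normc.normc1. Qed.

Lemma normcr a : normc a%:C = `|a|.
Proof. by rewrite normc_sqrt/= expr0n/= addr0 sqrtr_sqr. Qed.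

Lemma normc_eq0 z : (normc z == 0) = (z == 0).
Proof.
apply/eqP/eqP => [|->]; last exact: normc0.
exact: ComplexField.Normc.eq0_normc.
Qed.

Lemma normc_gt0 z : (0 < normc z) = (z != 0).
Proof. by rewrite lt_neqAle normc_ge0 andbT eq_sym normc_eq0. Qed.

Lemma normc_Re z : `|Re z| <= normc z.
Proof. by rewrite normc_sqrt -sqrtr_sqr ler_wsqrtr// lerDl sqr_ge0. Qed.

Lemma normc_Im z : `|Im z| <= normc z.
Proof. by rewrite normc_sqrt -sqrtr_sqr ler_wsqrtr// lerDr sqr_ge0. Qed.

Lemma normc_ReIm z : normc z <= `|Re z| + `|Im z|.
Proof.
rewrite -(@ler_pXn2r _ 2)// ?nnegrE ?addr_ge0 ?normc_ge0//.
rewrite normc_sq sqrrD !real_normK ?num_real// -addrA lerD2l lerDr.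
by rewrite mulrn_wge0// mulr_ge0.
Qed.

Lemma normc_sum (I : Type) (r : seq I) (P : pred I) (F : I -> R[i]) :
  normc (\sum_(i <- r | P i) F i) <= \sum_(i <- r | P i) normc (F i).
Proof.
elim/big_ind2 : _ => //; first by rewrite normc0.
by move=> x y z w xy zw; rewrite (le_trans (normcD _ _))// lerD.
Qed.

Lemma Re_sum (I : Type) (r : seq I) (P : pred I) (F : I -> R[i]) :
  Re (\sum_(i <- r | P i) F i) = \sum_(i <- r | P i) Re (F i).
Proof. by elim/big_rec2 : _ => // i x y _ <-; rewrite Re_addc. Qed.

Lemma Im_sum (I : Type) (r : seq I) (P : pred I) (F : I -> R[i]) :
  Im (\sum_(i <- r | P i) F i) = \sum_(i <- r | P i) Im (F i).
Proof. by elim/big_rec2 : _ => // i x y _ <-; rewrite Im_addc. Qed.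

Lemma Im_neq0 z : 0 < Im z -> z != 0.
Proof. by apply: contraTneq => ->; rewrite ltxx. Qed.

End modulus.

Section complex_integral.
Context d {T : measurableType d} {R : realType} (m : {measure set T -> \bar R}).
Implicit Types (D : set T) (f g : T -> R[i]).

Definition cintegral D f : R[i] :=
  (\int[m]_(x in D) Re (f x)) +i* (\int[m]_(x in D) Im (f x)).

Definition cintegrable D f :=
  m.-integrable D (fun x => (Re (f x))%:E) /\
  m.-integrable D (fun x => (Im (f x))%:E).

Variable D : set T.
Hypothesis mD : measurable D.

Lemma eq_cintegral f g : (forall x, D x -> f x = g x) ->
  cintegral D f = cintegral D g.
Proof.
by move=> fg; congr (_ +i* _); apply: eq_Rintegral => x /[!inE] Dx; rewrite fg.
Qed.

Lemma cintegrableD f g : cintegrable D f -> cintegrable D g ->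
  cintegrable D (fun x => f x + g x).
Proof.
move=> [f1 f2] [g1 g2]; split.
  by under eq_fun do rewrite Re_addc EFinD; exact: integrableD.
by under eq_fun do rewrite Im_addc EFinD; exact: integrableD.
Qed.

Lemma cintegralD f g : cintegrable D f -> cintegrable D g ->
  cintegral D (fun x => f x + g x) = cintegral D f + cintegral D g.
Proof.
move=> [f1 f2] [g1 g2]; rewrite /cintegral; apply: complex_ext => /=.
  by rewrite -RintegralD//; apply: eq_Rintegral => x _; rewrite Re_addc.
by rewrite -RintegralD//; apply: eq_Rintegral => x _; rewrite Im_addc.
Qed.

Lemma integrable_lin (a b : R) (f g : T -> R) :
  m.-integrable D (EFin \o f) -> m.-integrable D (EFin \o g) ->
  m.-integrable D (EFin \o (fun x => a * f x + b * g x)).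
Proof.
move=> fi gi.
have -> : EFin \o (fun x => a * f x + b * g x) =
    (fun x => a%:E * (f x)%:E + b%:E * (g x)%:E)%E by [].
by apply: integrableD => //; apply: integrableZl.
Qed.

Lemma Rintegral_lin (a b : R) (f g : T -> R) :
  m.-integrable D (EFin \o f) -> m.-integrable D (EFin \o g) ->
  \int[m]_(x in D) (a * f x + b * g x) =
  a * \int[m]_(x in D) f x + b * \int[m]_(x in D) g x.
Proof.
move=> fi gi; rewrite RintegralD ?RintegralZl//.
  by apply: eq_integrable (integrableZl mD a fi).
by apply: eq_integrable (integrableZl mD b gi).
Qed.

Lemma cintegrableZ (c : R[i]) f : cintegrable D f ->
  cintegrable D (fun x => c * f x).
Proof.
move=> [f1 f2]; split.
  by under eq_fun do rewrite Re_mulc -mulNr; exact: integrable_lin.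
by under eq_fun do rewrite Im_mulc; exact: integrable_lin.
Qed.

Lemma cintegralZ (c : R[i]) f : cintegrable D f ->
  cintegral D (fun x => c * f x) = c * cintegral D f.
Proof.
move=> [f1 f2]; rewrite /cintegral; apply: complex_ext => /=.
  under eq_Rintegral do rewrite Re_mulc -mulNr.
  by rewrite Rintegral_lin// Re_mulc mulNr.
under eq_Rintegral do rewrite Im_mulc.
by rewrite Rintegral_lin// Im_mulc.
Qed.

Lemma cintegrableB f g : cintegrable D f -> cintegrable D g ->
  cintegrable D (fun x => f x - g x).
Proof.
move=> fi gi; have := cintegrableD fi (cintegrableZ (-1) gi).
by under eq_fun do rewrite mulN1r.
Qed.

Lemma cintegralB f g : cintegrable D f -> cintegrable D g ->
  cintegral D (fun x => f x - g x) = cintegral D f - cintegral D g.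
Proof.
move=> fi gi; rewrite -mulN1r -cintegralZ// -cintegralD//; last exact: cintegrableZ.
by apply: eq_cintegral => x _; rewrite mulN1r.
Qed.

(** Rotating the value of the integral onto the positive real axis reduces
    the triangle inequality to the monotonicity of real integrals. *)
Lemma normc_cintegral f (g : T -> R) : cintegrable D f ->
  m.-integrable D (EFin \o g) -> (forall x, D x -> normc (f x) <= g x) ->
  normc (cintegral D f) <= \int[m]_(x in D) g x.
Proof.
move=> fi gi fg; set I := cintegral D f.
have [I0|I0] := eqVneq I 0.
  rewrite I0 normc0; apply: Rintegral_ge0 => x Dx.
  by rewrite (le_trans (normc_ge0 (f x)))// fg.
have nI : 0 < normc I by rewrite normc_gt0.
rewrite -(ler_pM2l nI) -expr2.
have -> : normc I ^+ 2 = Re (conjc I * I).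
  by rewrite normc_sq Re_mulc; case: I {I0 nI} => a b /=; rewrite !expr2; ring.
rewrite -cintegralZ// -RintegralZl//; apply: le_Rintegral => //.
- exact: (cintegrableZ (conjc I) fi).1.
- exact: eq_integrable (integrableZl mD (normc I) gi).
- move=> x Dx; apply: (le_trans (ler_norm _)); apply: (le_trans (normc_Re _)).
  rewrite normcM; have -> : normc (conjc I) = normc I.
    by rewrite !normc_sqrt; case: I {I0 nI} => a b /=; rewrite sqrrN.
  by rewrite ler_wpM2l ?normc_ge0// fg.
Qed.

End complex_integral.

Section complex_convergence.
Context {R : realType} {T : Type} (F : set_system T) {FF : Filter F}.
Implicit Types (f g : T -> R[i]) (l k : R[i]).

Definition ccvg f l :=
  (Re (f x) @[x --> F] --> Re l) /\ (Im (f x) @[x --> F] --> Im l).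

Lemma ccvg_cst l : ccvg (fun=> l) l.
Proof. by split; exact: cvg_cst. Qed.

Lemma ccvg_real (f : T -> R) (l : R) : f x @[x --> F] --> l ->
  ccvg (fun x => (f x)%:C) l%:C.
Proof. by move=> cf; split=> //=; exact: cvg_cst. Qed.

Lemma ccvgD f g l k : ccvg f l -> ccvg g k -> ccvg (fun x => f x + g x) (l + k).
Proof.
move=> [f1 f2] [g1 g2]; split.
  by under eq_fun do rewrite Re_addc; rewrite Re_addc; exact: cvgD.
by under eq_fun do rewrite Im_addc; rewrite Im_addc; exact: cvgD.
Qed.

Lemma ccvgM f g l k : ccvg f l -> ccvg g k -> ccvg (fun x => f x * g x) (l * k).
Proof.
move=> [f1 f2] [g1 g2]; split.
  by under eq_fun do rewrite Re_mulc; rewrite Re_mulc; apply: cvgB; exact: cvgM.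
by under eq_fun do rewrite Im_mulc; rewrite Im_mulc; apply: cvgD; exact: cvgM.
Qed.

Lemma ccvgN f l : ccvg f l -> ccvg (fun x => - f x) (- l).
Proof.
move=> cf; have := ccvgM (ccvg_cst (-1)) cf.
by under eq_fun do rewrite mulN1r; rewrite mulN1r.
Qed.

Lemma ccvgB f g l k : ccvg f l -> ccvg g k -> ccvg (fun x => f x - g x) (l - k).
Proof. by move=> cf cg; apply: ccvgD => //; exact: ccvgN. Qed.

Lemma cvg_normc_sq f l : ccvg f l ->
  normc (f x) ^+ 2 @[x --> F] --> normc l ^+ 2.
Proof.
move=> [f1 f2]; under eq_fun do rewrite normc_sq !expr2.
by rewrite normc_sq !expr2; apply: cvgD; exact: cvgM.
Qed.

Lemma cvg_normc f l : ccvg f l -> normc (f x) @[x --> F] --> normc l.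
Proof.
move=> /cvg_normc_sq fl; under eq_fun do rewrite normc_sqrt -normc_sq.
rewrite normc_sqrt -normc_sq.
exact: (cvg_comp _ _ fl (@sqrt_continuous R _)).
Qed.

Lemma ccvgV f l : l != 0 -> ccvg f l -> ccvg (fun x => (f x)^-1) l^-1.
Proof.
move=> l0 fl; have := cvg_normc_sq fl => fl2; case: fl => f1 f2.
have q : (normc (f x) ^+ 2)^-1 @[x --> F] --> (normc l ^+ 2)^-1.
  by apply: cvgV => //; rewrite expf_eq0/= normc_eq0.
split.
  under eq_fun do rewrite Re_invc -normc_sq.
  by rewrite Re_invc -normc_sq; exact: cvgM.
under eq_fun do rewrite Im_invc -normc_sq.
by rewrite Im_invc -normc_sq; apply: cvgM => //; exact: cvgN.
Qed.

Lemma ccvg_sum (I : Type) (r : seq I) (f : I -> T -> R[i]) (l : I -> R[i]) :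
  (forall i, ccvg (f i) (l i)) ->
  ccvg (fun x => \sum_(i <- r) f i x) (\sum_(i <- r) l i).
Proof.
move=> fl; elim: r => [|i r ih].
  by under eq_fun do rewrite big_nil; rewrite big_nil; exact: ccvg_cst.
by under eq_fun do rewrite big_cons; rewrite big_cons; exact: ccvgD.
Qed.

Lemma cvg_normc_sub f l : ccvg f l -> normc (f x - l) @[x --> F] --> 0.
Proof.
move=> fl; rewrite -(@normc0 R) -(subrr l); apply: cvg_normc.
by apply: ccvgB => //; exact: ccvg_cst.
Qed.

End complex_convergence.

Section complex_continuous.
Context {R : realType}.
Implicit Types f g : R -> R[i].

Definition ccontinuous f := forall x : R, ccvg (nbhs x) f (f x).

Lemma ccontinuous_Re f : ccontinuous f -> continuous (fun x => Re (f x)).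
Proof. by move=> cf x; exact: (cf x).1. Qed.

Lemma ccontinuous_Im f : ccontinuous f -> continuous (fun x => Im (f x)).
Proof. by move=> cf x; exact: (cf x).2. Qed.

Definition cbounded f := exists M : R, forall x, normc (f x) <= M.

Lemma ccontinuous_cst c : ccontinuous (fun=> c).
Proof. by move=> x; exact: ccvg_cst. Qed.

Lemma ccontinuous_real (f : R -> R) : continuous f -> ccontinuous (fun x => (f x)%:C).
Proof. by move=> cf x; apply: ccvg_real; exact: cf. Qed.

Lemma ccontinuousM f g : ccontinuous f -> ccontinuous g ->
  ccontinuous (fun x => f x * g x).
Proof. by move=> cf cg x; exact: ccvgM. Qed.

Lemma ccontinuousB f g : ccontinuous f -> ccontinuous g ->
  ccontinuous (fun x => f x - g x).
Proof. by move=> cf cg x; exact: ccvgB. Qed.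

Lemma ccontinuousV f : ccontinuous f -> (forall x, f x != 0) ->
  ccontinuous (fun x => (f x)^-1).
Proof. by move=> cf f0 x; exact: ccvgV. Qed.

Lemma ccontinuousX f n : ccontinuous f -> ccontinuous (fun x => f x ^+ n).
Proof.
move=> cf; elim: n => [|n ih].
  by under eq_fun do rewrite expr0; exact: ccontinuous_cst.
by under eq_fun do rewrite exprS; exact: ccontinuousM.
Qed.

Lemma cboundedM f g : cbounded f -> cbounded g -> cbounded (fun x => f x * g x).
Proof.
move=> [M fM] [K gK]; exists (M * K) => x.
by rewrite normcM ler_pM ?normc_ge0.
Qed.

Lemma cbounded_cst c : cbounded (fun=> c). Proof. by exists (normc c). Qed.

Lemma cboundedX f n : cbounded f -> cbounded (fun x => f x ^+ n).
Proof.
move=> cf; elim: n => [|n ih].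
  by under eq_fun do rewrite expr0; exact: cbounded_cst.
by under eq_fun do rewrite exprS; exact: cboundedM.
Qed.

Lemma bounded_continuous_integrable (P : probR R) (f : R -> R) :
  continuous f -> (exists M, forall x, `|f x| <= M) ->
  P.-integrable setT (EFin \o f).
Proof.
move=> cf [M fM]; apply: measurable_bounded_integrable => //.
- by rewrite [X in (X < _)%E](@probability_setT _ _ _ P) ltry.
- exact: continuous_measurable_fun.
- exists M; split; first exact: num_real.
  by move=> K MK x _; apply: le_trans (ltW MK); exact: fM.
Qed.

Lemma cbounded_cintegrable (P : probR R) f : ccontinuous f -> cbounded f ->
  cintegrable P setT f.
Proof.
move=> cf [M fM]; split; apply: bounded_continuous_integrable;
  [exact: ccontinuous_Re| |exact: ccontinuous_Im|];
  exists M => x; apply: le_trans (fM x).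
- exact: normc_Re.
- exact: normc_Im.
Qed.

Lemma cintegral_cst (P : probR R) (c : R[i]) : cintegral P setT (fun=> c) = c.
Proof.
rewrite /cintegral !Rintegral_cst//= probability_setT/= !mulr1.
by case: c.
Qed.

Lemma normc_cintegral_le (P : probR R) f (M : R) : ccontinuous f ->
  (forall x, normc (f x) <= M) -> normc (cintegral P setT f) <= M.
Proof.
move=> cf fM; have -> : M = \int[P]_(x in setT) (cst M x).
  by rewrite Rintegral_cst//= probability_setT/= mulr1.
apply: normc_cintegral => //.
- by apply: cbounded_cintegrable => //; exists M.
- apply: bounded_continuous_integrable; first by move=> x; exact: cvg_cst.
  by exists `|M|.
Qed.

End complex_continuous.

Section resolvent.
Context {R : realType}.
Implicit Types z w : R[i].

Lemma resolvent_neq0 z (x : R) : 0 < Im z -> z - x%:C != 0.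
Proof. by move=> z0; rewrite Im_neq0// !ReImE oppr0 addr0. Qed.

Lemma resolvent_continuous z : 0 < Im z -> ccontinuous (fun x => (z - x%:C)^-1).
Proof.
move=> z0; apply: ccontinuousV => [|x]; last exact: resolvent_neq0.
apply: ccontinuousB; first exact: ccontinuous_cst.
by apply: ccontinuous_real => x; exact: cvg_id.
Qed.

Lemma normc_resolvent_ge z (x : R) : 0 < Im z -> Im z <= normc (z - x%:C).
Proof.
move=> z0; apply: le_trans (normc_Im _).
by rewrite !ReImE oppr0 addr0 ler_norm.
Qed.

(** In the upper half plane the distance to the real line bounds every resolvent,
    which is why all the functions integrated below are bounded. *)
Lemma normc_resolvent z (x : R) : 0 < Im z -> normc (z - x%:C)^-1 <= (Im z)^-1.
Proof.
move=> z0; rewrite normcV lef_pV2 ?posrE ?normc_resolvent_ge//.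
by rewrite normc_gt0 resolvent_neq0.
Qed.

Lemma resolvent_bounded z : 0 < Im z -> cbounded (fun x => (z - x%:C)^-1).
Proof. by move=> z0; exists (Im z)^-1 => x; exact: normc_resolvent. Qed.

Lemma resolvent_integrable (P : probR R) z : 0 < Im z ->
  cintegrable P setT (fun x => (z - x%:C)^-1).
Proof.
by move=> z0; apply: cbounded_cintegrable;
  [exact: resolvent_continuous|exact: resolvent_bounded].
Qed.

Lemma cauchy_transformE (P : probR R) z :
  cauchy_transform P z = cintegral P setT (fun x => (z - x%:C)^-1).
Proof. by []. Qed.

Lemma normc_cauchy_transform (P : probR R) z : 0 < Im z ->
  normc (cauchy_transform P z) <= (Im z)^-1.
Proof.
move=> z0; apply: normc_cintegral_le; first exact: resolvent_continuous.
by move=> x; exact: normc_resolvent.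
Qed.

End resolvent.

(** * Empirical integrals, the interaction identity and a Gronwall estimate *)

Section empirical_integral.
Context {R : realType} {n : nat} (y : 'rV[R]_n.+1).

Lemma ge0_integral_empirical (g : measurableTypeR R -> \bar R) :
  (forall x, (0 <= g x)%E) -> measurable_fun setT g ->
  (\int[empirical y]_x g x = (n.+1%:R^-1)%:E * \sum_(i < n.+1) g (y ord0 i))%E.
Proof.
move=> g0 mg.
have k0 : 0 <= (n.+1%:R^-1 : R) by rewrite invr_ge0.
pose D (i : nat) : {measure set (measurableTypeR R) -> \bar R} :=
  @dirac _ (measurableTypeR R) (y ord0 (inord i)) R.
rewrite (@eq_measure_integral _ _ _ _ (mscale (NngNum k0) (msum D n.+1))).
  rewrite ge0_integral_mscale//= ge0_integral_measure_sum//; congr (_ * _)%E.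
  apply: eq_bigr => i _.
  by rewrite integral_dirac// diracT mul1e inord_val.
move=> A mA _; rewrite /= /mscale /= /empirical /msum; congr (_ * _)%E.
by apply: eq_bigr => i _; rewrite /D inord_val.
Qed.

Lemma Rintegral_empirical (f : R -> R) : continuous f ->
  \int[empirical y]_x f x = n.+1%:R^-1 * \sum_(i < n.+1) f (y ord0 i).
Proof.
move=> cf; have mf : measurable_fun setT (EFin \o f : measurableTypeR R -> \bar R).
  by apply/measurable_EFinP; exact: continuous_measurable_fun.
have pE : ((EFin \o f)^\+)%E = (fun x => (Num.max (f x) 0)%:E).
  by apply/funext => x; rewrite funeposE EFin_max.
have nE : ((EFin \o f)^\-)%E = (fun x => (Num.max (- f x) 0)%:E).
  by apply/funext => x; rewrite funenegE EFin_max.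
rewrite /Rintegral integralE !ge0_integral_empirical//; last 2 first.
- exact: measurable_funeneg.
- exact: measurable_funepos.
rewrite pE nE !sumEFin -!EFinM -EFinB/= -mulrBr -sumrB; congr (_ * _).
by apply: eq_bigr => i _; case: (lerP 0 (f (y ord0 i))) => f0;
  [rewrite max_r ?subr0; lra|rewrite max_l; lra].
Qed.

Lemma cintegral_empirical (f : R -> R[i]) : ccontinuous f ->
  cintegral (empirical y) setT f = (n.+1%:R^-1)%:C * \sum_(i < n.+1) f (y ord0 i).
Proof.
move=> cf; rewrite /cintegral !Rintegral_empirical; last 2 first.
- exact: ccontinuous_Im.
- exact: ccontinuous_Re.
by apply: complex_ext; [rewrite [RHS]Re_mulrc Re_sum|rewrite [RHS]Im_mulrc Im_sum].
Qed.

End empirical_integral.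

(** The interior of the chamber consists of strictly ordered configurations:
    raising a coordinate by a small amount must keep it below the previous ones. *)
Lemma weyl_chamber_interior (R : realType) N (x : 'rV[R]_N) (i j : 'I_N) :
  (weyl_chamber R N)° x -> (i < j)%N -> x ord0 j < x ord0 i.
Proof.
move=> /nbhs_ballP[e /= e0 xe] ij.
pose h := \row_k (x ord0 k + (k == j)%:R * (e / 2)).
have /xe/(_ i j (ltnW ij)) : ball x e h.
  split=> // a k; rewrite ord1 /ball/= !mxE.
  have -> : x 0 k - (x 0 k + (k == j)%:R * (e / 2)) = - ((k == j)%:R * (e / 2)).
    by ring.
  rewrite normrN; case: eqVneq => _; rewrite ?mul0r ?normr0 ?mul1r//.
  by rewrite ger0_norm; lra.
rewrite !mxE eqxx (_ : i == j = false) ?mul0r ?addr0 ?mul1r; first by lra.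
by apply/eqP => ijE; rewrite ijE ltnn in ij.
Qed.

(** Summation over ordered pairs of distinct indices is invariant under
    exchanging the two indices. *)
Lemma sum_antisymmetric (F : numDomainType) n (T : 'I_n -> 'I_n -> F) :
  (forall i j, i != j -> T i j + T j i = 0) ->
  \sum_i \sum_(j | j != i) T i j = 0.
Proof.
move=> T0; set S := \sum_i _.
suff : S + S = 0 by move/eqP; rewrite -mulr2n mulrn_eq0/= => /eqP.
rewrite {2}/S (exchange_big_dep xpredT)//= /S -big_split/=; apply: big1 => i _.
under [X in _ + X]eq_bigl do rewrite eq_sym.
by rewrite -big_split/=; apply: big1 => j ji; rewrite T0// eq_sym.
Qed.

Section interaction.
Context {F : numFieldType} {n : nat}.
Variables (y : 'I_n -> F) (Z : F).
Hypotheses (yI : forall i j, i != j -> y i != y j) (Zy : forall i, Z != y i).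
Let u i := (Z - y i)^-1.

(** The identity that turns the pair interaction into a product of resolvent
    sums, with a diagonal correction: in each pair, the singular factor
    cancels against the difference of the two squared resolvents. *)
Lemma interaction_resolvent :
  \sum_i u i ^+ 2 * \sum_(j | j != i) (y i - y j)^-1 =
  (\sum_i u i) * (\sum_i u i ^+ 2) - \sum_i u i ^+ 3.
Proof.
have -> : (\sum_i u i) * (\sum_i u i ^+ 2) - \sum_i u i ^+ 3 =
    \sum_i \sum_(j | j != i) u i * u j ^+ 2.
  rewrite mulr_suml -sumrB; apply: eq_bigr => i _.
  by rewrite (bigD1 i)//= mulrDr -exprS mulr_sumr addrC addKr.
apply/eqP; rewrite -subr_eq0 -sumrB; apply/eqP.
transitivity (\sum_i \sum_(j | j != i) (u i ^+ 2 * (y i - y j)^-1 - u i * u j ^+ 2)).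
  by apply: eq_bigr => i _; rewrite sumrB mulr_sumr.
apply: sum_antisymmetric => i j ij; rewrite /u.
have H3 : y i - y j != 0 by rewrite subr_eq0 yI.
have H1 : Z - y i != 0 by rewrite subr_eq0.
have H2 : Z - y j != 0 by rewrite subr_eq0.
move: (y i) (y j) H1 H2 H3 => a b H1 H2 H3; field.
by rewrite H1 H2 H3 -opprB oppr_eq0 H3.
Qed.

End interaction.

(** Multiplying v by the integrating factor exp (- K s) and removing the forcing
    term e s leaves a nonincreasing function. Only the open interval carries
    a derivative, since the flow may start on the boundary of the chamber. *)
Lemma gronwall (R : realType) (v dv : R -> R) (K e t : R) : 0 <= K -> 0 <= e ->
  0 <= t -> {within `[0, t], continuous v} ->
  (forall s, 0 < s < t -> is_derive s 1 v (dv s)) ->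
  (forall s, 0 < s < t -> dv s <= K * v s + e) ->
  v t <= expR (K * t) * (v 0 + e * t).
Proof.
move=> K0 e0 t0 cv hd hle.
pose w s := expR (- (K * s)) * v s - e * s.
have dE (s : R) : is_derive s 1 (fun s => expR (- (K * s))) (- K * expR (- (K * s))).
  have -> : (fun s => expR (- (K * s))) = expR \o (fun s => - K * s).
    by apply/funext => x /=; rewrite mulNr.
  by apply: is_derive_eq; rewrite /GRing.scale/= mulr1 mulrC !mulNr.
have dw s : 0 < s < t ->
    is_derive s 1 w (expR (- (K * s)) * (dv s - K * v s) - e).
  move=> st; have := hd _ st => dvs; have dEs := dE s.
  apply: is_derive_eq.
  by rewrite /GRing.scale/=; ring.
have wd s : s \in `]0, t[%R -> derivable w s 1.
  by rewrite in_itv/= => /dw[].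
have w'le s : s \in `]0, t[%R -> derive1 w s <= 0.
  rewrite in_itv/= => st; rewrite derive1E; have [_ ->] := dw _ st.
  rewrite subr_le0 (@le_trans _ _ (expR (- (K * s)) * e))//.
    by rewrite ler_wpM2l ?expR_ge0//; have := hle _ st; lra.
  rewrite ler_piMl// -[leRHS]expR0 ler_expR oppr_le0 mulr_ge0//.
  by case/andP: st => /ltW.
have wc : {within `[0, t], continuous w}.
  apply/subspace_continuousP => s st.
  have cvs := (subspace_continuousP _ _).1 cv s st.
  apply: cvgB; first apply: cvgM => //; apply: cvg_within_filter.
    have /derivable1_diffP/differentiable_continuous :
      derivable (fun s => expR (- (K * s))) s 1 by have [] := dE s.
    exact.
  by apply: cvgM; [exact: cvg_cst|exact: cvg_id].
have it : t \in `[0, t]%R by rewrite in_itv/= t0 lexx.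
have i0 : 0 \in `[0, t]%R by rewrite in_itv/= t0 lexx.
have wle : w t <= w 0 := ler0_derive1_le_cc wd w'le wc it i0 t0.
have : expR (- (K * t)) * v t <= v 0 + e * t.
  by move: wle; rewrite /w !mulr0 oppr0 expR0 mul1r addr0; lra.
by rewrite expRN ler_pdivrMl ?expR_gt0.
Qed.

Section complex_derivative.
Context {R : realType}.
Implicit Types (f g : R -> R[i]) (s : R) (df dg : R[i]).

(** Derivative along the real line, by components, in the same way as the
    Cauchy transform is a pair of real integrals. *)
Definition is_cderive s f df :=
  is_derive s 1 (fun t => Re (f t)) (Re df) /\
  is_derive s 1 (fun t => Im (f t)) (Im df).

Lemma is_cderiveD s f g df dg : is_cderive s f df -> is_cderive s g dg ->
  is_cderive s (fun t => f t + g t) (df + dg).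
Proof.
move=> [f1 f2] [g1 g2]; split.
  by under eq_fun do rewrite Re_addc; rewrite Re_addc; exact: is_deriveD.
by under eq_fun do rewrite Im_addc; rewrite Im_addc; exact: is_deriveD.
Qed.

Lemma is_cderive_eq s f df dg : is_cderive s f df -> df = dg -> is_cderive s f dg.
Proof. by move=> h <-. Qed.

Lemma is_cderive_cst s (c : R[i]) : is_cderive s (fun=> c) 0.
Proof. by split; exact: is_derive_cst. Qed.

Lemma is_cderive_real s (f : R -> R) (df : R) : is_derive s 1 f df ->
  is_cderive s (fun t => (f t)%:C) df%:C.
Proof. by move=> h; split => //=; exact: is_derive_cst. Qed.

Lemma is_cderiveM s f g df dg : is_cderive s f df -> is_cderive s g dg ->
  is_cderive s (fun t => f t * g t) (df * g s + f s * dg).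
Proof.
move=> [f1 f2] [g1 g2]; split.
  under eq_fun do rewrite Re_mulc; apply: is_derive_eq.
  by rewrite !ReImE /GRing.scale/=; ring.
under eq_fun do rewrite Im_mulc; apply: is_derive_eq.
by rewrite !ReImE /GRing.scale/=; ring.
Qed.

Lemma is_cderiveV s f df : f s != 0 -> is_cderive s f df ->
  is_cderive s (fun t => (f t)^-1) (- df * (f s)^-1 ^+ 2).
Proof.
move=> fs0 [f1 f2].
pose q t := Re (f t) ^+ 2 + Im (f t) ^+ 2.
have q0 : q s != 0 by rewrite /q -normc_sq expf_eq0/= normc_eq0.
have dq : is_derive s 1 q (2 * (Re (f s) * Re df + Im (f s) * Im df)).
  by apply: is_derive_eq; rewrite /GRing.scale/=; ring.
have dqV : is_derive s 1 (fun t => (q t)^-1)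
    (- (2 * (Re (f s) * Re df + Im (f s) * Im df)) / q s ^+ 2).
  have [qd qE] := dq.
  split; first exact: derivableV.
  by rewrite deriveV// qE /GRing.scale/= mulrC mulrN mulNr.
split.
  under eq_fun do rewrite Re_invc; apply: is_derive_eq.
  rewrite !expr2 !ReImE Re_invc Im_invc /GRing.scale/=.
  by move: q0; rewrite /q; move: (Re (f s)) (Im (f s)) => a b q0; field.
under eq_fun do rewrite Im_invc; apply: is_derive_eq.
rewrite !expr2 !ReImE Re_invc Im_invc /GRing.scale/=.
by move: q0; rewrite /q; move: (Re (f s)) (Im (f s)) => a b q0; field.
Qed.

Lemma is_cderive_sum s (I : finType) (F : I -> R -> R[i]) (dF : I -> R[i]) :
  (forall i, is_cderive s (F i) (dF i)) ->
  is_cderive s (fun t => \sum_i F i t) (\sum_i dF i).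
Proof.
move=> h.
elim: (index_enum I) => [|i r ih].
  under eq_fun do rewrite big_nil; rewrite big_nil; exact: is_cderive_cst.
under eq_fun do rewrite big_cons; rewrite big_cons.
exact: is_cderiveD.
Qed.

Lemma is_derive_normc_sq s f df : is_cderive s f df ->
  is_derive s 1 (fun t => normc (f t) ^+ 2) (2 * Re (conjc (f s) * df)).
Proof.
move=> [f1 f2]; under eq_fun do rewrite normc_sq.
apply: is_derive_eq; rewrite Re_mulc /GRing.scale/=.
by case: (f s) => a b /=; ring.
Qed.

End complex_derivative.

(** * The finite flow along the characteristics of the limit *)

Lemma normc_mean_le (R : realType) n (F : 'I_n.+1 -> R[i]) (M : R) :
  (forall i, normc (F i) <= M) ->
  normc ((n.+1%:R^-1)%:C * \sum_i F i) <= M.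
Proof.
move=> FM; rewrite normcM normcr ger0_norm ?invr_ge0// ler_pdivrMl ?ltr0n//.
rewrite (le_trans (normc_sum _ _ _))// (@le_trans _ _ (\sum_(i < n.+1) M))//.
  by apply: ler_sum.
by rewrite sumr_const card_ord mulr_natl.
Qed.

Lemma cauchy_transform_empirical (R : realType) n (y : 'rV[R]_n.+1) z : 0 < Im z ->
  cauchy_transform (empirical y) z =
  (n.+1%:R^-1)%:C * \sum_i (z - (y ord0 i)%:C)^-1.
Proof.
move=> z0; rewrite cauchy_transformE cintegral_empirical//.
exact: resolvent_continuous.
Qed.

Section characteristics.
Context {R : realType} {n : nat} (x0 : 'rV[R]_n.+1) (phi : R -> 'rV[R]_n.+1).
Hypothesis hphi : is_flow x0 phi.
Implicit Types s : R.
Let N : R := n.+1%:R.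
Let y s := (Num.sqrt N)^-1 *: phi s.

Let N_gt0 : 0 < N. Proof. by rewrite ltr0n. Qed.

Lemma scaled_flow_neq s i j : 0 < s -> i != j -> y s ord0 i != y s ord0 j.
Proof.
case: hphi => _ _ _ h s0 ij; have [int _] := h _ s0.
rewrite !mxE (inj_eq (mulfI _)) ?invr_eq0 ?sqrtr_eq0 -?ltNge//.
have [ij'|ji|/val_inj ijE] := ltngtP i j; last by rewrite ijE eqxx in ij.
- by rewrite gt_eqF// (weyl_chamber_interior int).
- by rewrite lt_eqF// (weyl_chamber_interior int).
Qed.

(** The square roots of the two rescalings combine into the factor 1 / N of a
    mean-field interaction. *)
Lemma scaled_flow_derive s i : 0 < s ->
  is_derive s 1 (fun s => y s ord0 i)
    (N^-1 * \sum_(j | j != i) (y s ord0 i - y s ord0 j)^-1).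
Proof.
case: hphi => _ _ _ h s0; have [_ /(_ i) ds] := h _ s0.
under eq_fun do rewrite mxE; apply: is_derive_eq.
rewrite /GRing.scale/= !mulr_sumr; apply: eq_bigr => j _.
rewrite !mxE -mulrBr invfM invrK mulrA; congr (_ * _).
rewrite -{2}(sqr_sqrtr (ltW N_gt0)) expr2 invfM -mulrA mulVf ?mulr1//.
by rewrite sqrtr_eq0 -ltNge.
Qed.

Lemma scaled_flow_cvg s i : 0 <= s ->
  y u ord0 i @[u --> within [set` `[0, +oo[] (nbhs s)] --> y s ord0 i.
Proof.
case: hphi => /subspace_continuousP cphi _ _ _ s0.
have /cphi cs : `[0, +oo[%classic s by rewrite /= in_itv/= s0.
under eq_fun do rewrite mxE; rewrite mxE; apply: cvgM; first exact: cvg_cst.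
exact: (cvg_comp _ _ cs (@coord_continuous _ _ _ ord0 i _)).
Qed.

Variables (z g : R[i]) (d t : R).
Hypotheses (d0 : 0 < d) (t0 : 0 <= t)
  (dZ : forall s, 0 <= s <= t -> d <= Im (z + s%:C * g)).
Let Z (s : R) := z + s%:C * g.
Let u i s := (Z s - (y s ord0 i)%:C)^-1.
Let A s := (N^-1)%:C * \sum_i u i s - g.
Let B s := (N^-1)%:C * \sum_i u i s ^+ 2.
Let E s := (N^-1)%:C * ((N^-1)%:C * \sum_i u i s ^+ 3).

Let ImZ_gt0 s : 0 <= s <= t -> 0 < Im (Z s).
Proof. by move=> /dZ; exact: lt_le_trans. Qed.

Let normc_u s i : 0 <= s <= t -> normc (u i s) <= d^-1.
Proof.
move=> st; rewrite (le_trans (normc_resolvent _ _)) ?ImZ_gt0//.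
by rewrite lef_pV2 ?posrE ?ImZ_gt0// dZ.
Qed.

(** Along the straight characteristic Z, the deviation A of the transform from
    its initial target solves a linear equation: the transport term of the
    Burgers equation cancels, and only the diagonal correction E remains. *)
Lemma characteristic_derive s : 0 < s < t ->
  is_cderive s A (B s * A s - E s).
Proof.
move=> /andP[s0 st]; have sT : 0 <= s <= t by rewrite !ltW.
pose dy i := N^-1 * \sum_(j | j != i) (y s ord0 i - y s ord0 j)^-1.
have dyE i : (dy i)%:C = (N^-1)%:C *
    \sum_(j | j != i) ((y s ord0 i)%:C - (y s ord0 j)%:C)^-1.
  rewrite /dy rmorphM rmorph_sum/=; congr (_ * _); apply: eq_bigr => j _.
  by rewrite fmorphV rmorphB.
have dZs : is_cderive s Z g.
  have h : is_cderive s (fun s : R => s%:C) 1%:C.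
    by apply: (@is_cderive_real _ _ id); exact: is_derive_id.
  apply: is_cderive_eq.
    by apply: is_cderiveD; [exact: is_cderive_cst|
      apply: is_cderiveM; [exact: h|exact: is_cderive_cst]].
  by rewrite add0r mulr0 addr0 mul1r.
have du i : is_cderive s (u i) (- (g - (dy i)%:C) * u i s ^+ 2).
  apply: is_cderiveV; first by rewrite resolvent_neq0// ImZ_gt0.
  have h := is_cderiveM (is_cderive_cst s (-1))
    (is_cderive_real (scaled_flow_derive i s0)).
  have := is_cderiveD dZs h.
  under eq_fun do rewrite mulN1r.
  by move=> /is_cderive_eq; apply; rewrite mul0r add0r mulN1r.
have dS := is_cderive_sum du.
have dA := is_cderiveD (is_cderiveM (is_cderive_cst s (N^-1)%:C) dS)
  (is_cderive_cst s (- g)).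
apply: (is_cderive_eq dA).
rewrite mul0r add0r addr0.
transitivity ((N^-1)%:C * (\sum_i u i s ^+ 2 * (dy i)%:C) - g * B s).
  rewrite /B mulrCA -mulrBr; congr (_ * _).
  rewrite mulr_sumr -sumrB; apply: eq_bigr => i _; ring.
under eq_bigr do rewrite dyE mulrCA.
rewrite -mulr_sumr interaction_resolvent.
- by rewrite /A /B /E /u; ring.
- by move=> i j ij; rewrite -subr_eq0 -rmorphB/= fmorph_eq0 subr_eq0 scaled_flow_neq.
- by move=> i; rewrite -subr_eq0 resolvent_neq0// ImZ_gt0.
Qed.

Lemma characteristic_cvg s : 0 <= s <= t ->
  ccvg (within [set` `[0, t]] (nbhs s)) A (A s).
Proof.
move=> st; have /andP[s0 _] := st.
have sub : within [set` `[0, t]] (nbhs s) --> within [set` `[0, +oo[] (nbhs s).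
  by apply: within_subset => a /=; rewrite !in_itv/= => /andP[-> _].
apply: ccvgB; last exact: ccvg_cst.
apply: ccvgM; first exact: ccvg_cst.
apply: ccvg_sum => i; apply: ccvgV; first by rewrite resolvent_neq0// ImZ_gt0.
apply: ccvgB.
  apply: ccvgD; first exact: ccvg_cst.
  apply: ccvgM; last exact: ccvg_cst.
  by apply: ccvg_real; apply: cvg_within_filter; exact: cvg_id.
by apply: ccvg_real; move: (@scaled_flow_cvg s i s0); apply: cvg_trans; exact: (cvg_app _ sub).
Qed.

(** The factor B has modulus at most d^-2 and E at most d^-3 / N as long as the
    characteristic stays at height d, so the linear equation for A keeps the
    initial deviation under control up to a term that vanishes with 1 / N. *)
Lemma characteristic_bound :
  normc (cauchy_transform (empirical (y t)) (z + t%:C * g) - g) ^+ 2 <=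
  expR ((2 * d^-1 ^+ 2 + 1) * t) *
    (normc (cauchy_transform (empirical (y 0)) z - g) ^+ 2
      + (N^-1 * d^-1 ^+ 3) ^+ 2 * t).
Proof.
have T0 : 0 <= (0 : R) <= t by rewrite lexx.
have Tt : 0 <= t <= t by rewrite lexx t0.
have Z0 : Z 0 = z by rewrite /Z mul0r addr0.
rewrite !cauchy_transform_empirical; last 2 first.
- by rewrite -Z0; exact: ImZ_gt0.
- exact: ImZ_gt0.
have A0 : A 0 = (N^-1)%:C * \sum_i (z - (y 0 ord0 i)%:C)^-1 - g.
  by rewrite /A /u Z0.
rewrite -A0 -/(A t).
have normB s : 0 <= s <= t -> normc (B s) <= d^-1 ^+ 2.
  move=> st; apply: normc_mean_le => i; rewrite normcX.
  by rewrite lerXn2r ?nnegrE ?normc_ge0 ?invr_ge0 ?(ltW d0)// normc_u.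
have normE s : 0 <= s <= t -> normc (E s) <= N^-1 * d^-1 ^+ 3.
  move=> st; rewrite normcM normcr ger0_norm ?invr_ge0 ?(ltW N_gt0)//.
  rewrite ler_wpM2l ?invr_ge0 ?(ltW N_gt0)//.
  apply: normc_mean_le => i; rewrite normcX.
  by rewrite lerXn2r ?nnegrE ?normc_ge0 ?invr_ge0 ?(ltW d0)// normc_u.
apply: (@gronwall _ (fun s => normc (A s) ^+ 2)
  (fun s => 2 * Re (conjc (A s) * (B s * A s - E s)))) => //.
- by rewrite addr_ge0// mulr_ge0// exprn_ge0// invr_ge0 ltW.
- by rewrite sqr_ge0.
- apply/subspace_continuousP => s; rewrite /= in_itv/= => st.
  by apply: cvg_normc_sq; exact: characteristic_cvg.
- by move=> s st; apply: is_derive_normc_sq; exact: characteristic_derive.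
move=> s /andP[s0 st]; have sT : 0 <= s <= t by rewrite !ltW.
have nB := normB _ sT; have nE := normE _ sT.
have conjE : normc (conjc (A s)) = normc (A s).
  by rewrite !normc_sqrt; case: (A s) => a b /=; rewrite sqrrN.
have h1 : Re (conjc (A s) * (B s * A s - E s)) <=
    normc (A s) * (d^-1 ^+ 2 * normc (A s) + N^-1 * d^-1 ^+ 3).
  rewrite (le_trans (ler_norm _))// (le_trans (normc_Re _))// normcM conjE.
  rewrite ler_wpM2l ?normc_ge0// (le_trans (normcD _ _))// normc_opp normcM.
  by rewrite lerD// ler_wpM2r ?normc_ge0.
have := sqr_ge0 (normc (A s) - N^-1 * d^-1 ^+ 3).
rewrite sqrrB; move: h1; rewrite mulrDr.
move: (normc (A s)) (N^-1 * d^-1 ^+ 3) (d^-1 ^+ 2) => a e D; lra.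
Qed.

End characteristics.

(** * Ultrafilter limits and Riemann-Stieltjes sums *)

Section ultrafilter_limits.
Context {R : realType} {T : Type}.

(** A cluster point along an ultrafilter is a limit, and the segment is compact. *)
Lemma ultra_bounded_cvg (U : set_system T) (u : T -> R) (a b : R) :
  UltraFilter U -> (forall n, a <= u n <= b) -> exists l : R, u @ U --> l.
Proof.
move=> UU uab.
have uU : (u @ U) `[a, b]%classic.
  by apply: (@filterS _ U _ setT) filterT => n _; rewrite /= in_itv/=; exact: uab.
have [l [_ lcl]] := segment_compact _ uU.
exists l => V lV; have [//|UnV] := in_ultra_setVsetC (u @^-1` V) UU.
by have [x [nVx /nVx]] := lcl (~` V) V UnV lV.
Qed.

(** Ultrafilters replace subsequences: a filter on which u stays away from l
    extends to an ultrafilter along which u does not converge to l. *)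
Lemma cvg_ultra (F : set_system T) (u : T -> R) (l : R) : ProperFilter F ->
  (forall U, UltraFilter U -> F `<=` U -> u @ U --> l) -> u @ F --> l.
Proof.
move=> FF ul V lV; apply: contrapT => nFV.
have {}nFV : ~ F (u @^-1` V) := nFV.
pose D := ~` (u @^-1` V).
have WF : ProperFilter (within D F).
  apply: Build_ProperFilter_ex.
  move=> P FP; apply: contrapT => nP; apply: nFV.
  have FP' : F (fun x => D x -> P x) := FP.
  apply: filterS FP' => x DP; apply: contrapT => nVx.
  by apply: nP; exists x; exact: DP.
have [U [UU WU]] := ultraFilterLemma WF.
have FU : F `<=` U by apply: subset_trans WU => P FP; apply: filterS FP => x Px _.
have UD : U D by apply: WU; apply: filterS (@filterT _ F _) => x _.
have UV : U (u @^-1` V) := ul U UU FU V lV.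
have [x [Dx Vx]] := @filter_ex _ U _ _ (filterI UD UV).
exact: Dx Vx.
Qed.

End ultrafilter_limits.

Section riemann_stieltjes.
Context {R : realType}.
Implicit Types (P : probR R) (f : R -> R).

Definition distfun P (x : R) : R := fine (P `]-oo, x]%classic).

Lemma distfun_itv P (a b : R) : a <= b -> fine (P `]a, b]%classic) = distfun P b - distfun P a.
Proof.
move=> ab; have -> : `]a, b]%classic = `]-oo, b] `\` `]-oo, a].
  by rewrite -[RHS]setCK setCD setCitvl setUC -[LHS]setCK setCitv.
rewrite measureD//; last by rewrite -ge0_fin_numE ?fin_num_measure.
rewrite setIidr; last exact: subset_itvl.
by rewrite fineB// fin_num_measure.
Qed.

Lemma distfun_ge0 P x : 0 <= distfun P x.
Proof. by rewrite fine_ge0. Qed.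

Lemma distfun_le1 P x : distfun P x <= 1.
Proof. by rewrite -lee_fin fineK ?fin_num_measure// probability_le1. Qed.

Lemma distfun_nd P : {homo distfun P : x y / x <= y}.
Proof. by move=> x y xy; rewrite -subr_ge0 -distfun_itv// fine_ge0. Qed.

Let bci P f (D : set (measurableTypeR R)) : measurable D -> continuous f ->
  (exists M, forall x, `|f x| <= M) -> P.-integrable D (EFin \o f).
Proof.
move=> mD cf bf; apply: integrableS (bounded_continuous_integrable P cf bf) => //.
Qed.

Lemma stieltjes_cell P f (a b c e : R) : a <= b -> continuous f ->
  (exists M, forall x, `|f x| <= M) ->
  (forall x, a < x <= b -> `|f x - c| <= e) ->
  `|\int[P]_(x in `]a, b]) f x - c * (distfun P b - distfun P a)| <= e * (distfun P b - distfun P a).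
Proof.
move=> ab cf bf fe; rewrite -distfun_itv//.
have ci : P.-integrable `]a, b] (EFin \o cst c).
  by apply: bci => //; [move=> x; exact: cvg_cst|exists `|c|].
have ei : P.-integrable `]a, b] (EFin \o cst e).
  by apply: bci => //; [move=> x; exact: cvg_cst|exists `|e|].
have fi : P.-integrable `]a, b] (EFin \o f) by exact: bci.
have dcf : continuous (fun x => f x - c).
  by move=> x; apply: cvgB; [exact: cf|exact: cvg_cst].
have dbf : exists M, forall x, `|f x - c| <= M.
  have [M fM] := bf; exists (M + `|c|) => x.
  by rewrite (le_trans (ler_normB _ _))// lerD.
rewrite -!Rintegral_cst// -RintegralB//.
rewrite (le_trans (le_normr_Rintegral _ _))//; first exact: bci.
apply: le_Rintegral => //.
  apply: bci => //; last by have [M fM] := dbf; exists M => x; rewrite normr_id.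
  by move=> x; apply: (continuous_comp (dcf x)); exact: norm_continuous.
Qed.

(** Comparison of an integral with its Riemann-Stieltjes sum, with an error
    that depends on the measure only through its total mass. *)
Lemma stieltjes_sum P f (p : nat -> R) (e : R) k : continuous f ->
  (exists M, forall x, `|f x| <= M) ->
  {homo p : i j / (i <= j)%N >-> i <= j} ->
  (forall i x, (i < k)%N -> p i < x <= p i.+1 -> `|f x - f (p i)| <= e) ->
  `|\int[P]_(x in `](p 0), (p k)]) f x -
     \sum_(i < k) f (p i) * (distfun P (p i.+1) - distfun P (p i))|
    <= e * (distfun P (p k) - distfun P (p 0)).
Proof.
move=> cf bf pnd; elim: k => [|k ih] fe.
  by rewrite big_ord0 set_itv_ge ?bnd_simp ?ltxx// Rintegral_set0 !subrr normr0 mulr0.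
rewrite big_ord_recr/= (@itv_bndbnd_setU _ _ _ (BRight (p k))) ?bnd_simp ?pnd//.
rewrite Rintegral_setU//; last 2 first.
- by apply: bci => //; exact: measurableU.
- apply/disj_setPS => y [/=]; rewrite 2!in_itv/= => /andP[_ yx] /andP[].
  by rewrite ltNge yx.
have h1 := ih (fun i x ik => fe i x (ltnW ik)).
have h2 := stieltjes_cell P (pnd _ _ (leqnSn k)) cf bf (fun x => fe k x (ltnSn k)).
rewrite opprD addrACA (le_trans (ler_normD _ _))// (le_trans (lerD h1 h2))//.
by rewrite le_eqVlt; apply/orP; left; apply/eqP; ring.
Qed.

Lemma heine f (a b e : R) : continuous f -> 0 < e ->
  exists2 d : R, 0 < d &
    forall x y, a <= x <= b -> `|x - y| < d -> `|f x - f y| <= e.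
Proof.
move=> cf e0.
have := (compact_near_coveringP _).1 (@segment_compact R a b).
move=> /(_ R 0^'+ (fun d x => forall y, `|x - y| < d -> `|f x - f y| <= e) _).
have pt x : `[a, b]%classic x -> \forall x' \near x & d \near 0^'+,
    forall y, `|x' - y| < d -> `|f x' - f y| <= e.
  move=> _; have e20 : 0 < e / 2 by rewrite divr_gt0.
  have /cvgrPdist_le/(_ _ e20)/nbhs_ballP[r /= r0 xr] := cf x.
  have r20 : 0 < r / 2 by rewrite divr_gt0.
  exists (ball x (r / 2), [set d | d < r / 2]) => /=.
    by split; [exact: nbhsx_ballx|exact: nbhs_right_lt].
  move=> [x' d] /= [xx' dr] y x'y; rewrite /ball/= in xx'.
  have h1 : `|f x - f x'| <= e / 2 by apply: xr; rewrite /ball/=; lra.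
  have h2 : `|f x - f y| <= e / 2.
    apply: xr; rewrite /ball/= (_ : x - y = (x - x') + (x' - y)); last by ring.
    by rewrite (le_lt_trans (ler_normD _ _))//; lra.
  rewrite (_ : f x' - f y = - (f x - f x') + (f x - f y)); last by ring.
  by rewrite (le_trans (ler_normD _ _))// normrN; lra.
move=> /(_ pt) h.
have [d [d0 hd]] := @filter_ex _ _ (at_right_proper_filter (0 : R)) _
  (filterI (nbhs_right_gt (0 : R)) h).
exists d => // x y xab; apply: hd.
by rewrite /= in_itv.
Qed.

(** A partition fine enough for f makes the Riemann-Stieltjes sums approximate
    the integral against every probability measure at once. *)
Lemma stieltjes_approx f (M a b e : R) : continuous f -> (forall x, `|f x| <= M) ->
  a < b -> 0 < e ->
  exists k (p : nat -> R), [/\ p 0%N = a, p k = b,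
    {homo p : i j / (i < j)%N >-> i < j},
    (forall i, (i < k)%N -> `|f (p i) - f (p i.+1)| <= e) &
    forall P, `|\int[P]_x f x -
        \sum_(i < k) f (p i) * (distfun P (p i.+1) - distfun P (p i))| <=
      e + M * (1 - (distfun P b - distfun P a))].
Proof.
move=> cf fM ab e0; have [d d0 hd] := heine a b cf e0.
have bf : exists M, forall x, `|f x| <= M by exists M.
pose k := (Num.truncn ((b - a) / d)).+1.
have k0 : 0 < (k%:R : R) by rewrite ltr0n.
have kd : (b - a) / k%:R < d.
  by rewrite ltr_pdivrMr// mulrC -ltr_pdivrMr// truncnS_gt.
pose p (i : nat) := a + i%:R * ((b - a) / k%:R).
have pS i : p i.+1 = p i + (b - a) / k%:R by rewrite /p -natr1; ring.
have s0 : 0 < (b - a) / k%:R by rewrite divr_gt0// subr_gt0.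
have pnd : {homo p : i j / (i <= j)%N >-> i <= j}.
  by move=> i j ij; rewrite lerD2l ler_wpM2r ?(ltW s0)// ler_nat.
have p0 : p 0%N = a by rewrite /p mul0r addr0.
have pk : p k = b.
  by rewrite /p mulrCA divff ?gt_eqF// mulr1 addrC subrK.
have pab i : (i <= k)%N -> a <= p i <= b.
  by move=> ik; rewrite -{1}p0 -pk !pnd.
have cell i x : (i < k)%N -> p i < x <= p i.+1 -> `|f x - f (p i)| <= e.
  move=> ik /andP[px xp]; rewrite distrC; apply: hd; first exact/pab/ltnW.
  by rewrite distrC gtr0_norm ?subr_gt0//; rewrite pS in xp; lra.
exists k, p; split=> // [i j ij|i ik|P].
- by rewrite ltrD2l ltr_pM2r// ltr_nat.
- apply: hd; first exact/pab/ltnW.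
  by rewrite distrC pS addrC addKr gtr0_norm.
have h := stieltjes_sum P cf bf pnd cell; rewrite p0 pk in h.
have -> : \int[P]_x f x = \int[P]_(x in `]a, b]) f x + \int[P]_(x in ~` `]a, b]) f x.
  have mab : measurable (`]a, b]%classic : set (measurableTypeR R)) by [].
  rewrite -Rintegral_setU//; first by rewrite setUv.
  - exact: measurableC.
  - by rewrite setUv; apply: bci.
  - by rewrite disj_set2E setICr.
rewrite addrAC (le_trans (ler_normD _ _))// lerD//.
  rewrite (le_trans h)// ler_piMr ?(ltW e0)//.
  by have := distfun_le1 P b; have := distfun_ge0 P a; lra.
have mab : measurable (~` `]a, b]%classic : set (measurableTypeR R)).
  exact: measurableC.
rewrite (le_trans (le_normr_Rintegral _ _))//; first exact: bci.
have -> : 1 - (distfun P b - distfun P a) = fine (P (~` `]a, b]%classic)).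
  rewrite probability_setC// -distfun_itv ?(ltW ab)// fineB//.
  by rewrite fin_num_measure.
rewrite -Rintegral_cst//; apply: le_Rintegral => //.
- apply: bci => //; last by exists M => x; rewrite normr_id.
  by move=> x; apply: (continuous_comp (cf x)); exact: norm_continuous.
- by apply: bci => //; [move=> x; exact: cvg_cst|exists `|M|].
Qed.

End riemann_stieltjes.

(** * Compactness of tight families of probability measures *)

Section right_regularization.
Context {R : realType} (G : R -> R).
Hypotheses (Gnd : {homo G : x y / x <= y}) (G01 : forall x, 0 <= G x <= 1).

(** The pointwise limit of distribution functions need not be right continuous;
    this is its right limit, written as an infimum by monotonicity. *)
Definition right_reg (x : R) : R := inf [set G y | y in `]x, +oo[%classic].

Let has_inf_G x : has_inf [set G y | y in `]x, +oo[%classic].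
Proof.
split; first by exists (G (x + 1)); exists (x + 1) => //=; rewrite in_itv/= andbT ltrDl.
by exists 0 => _ [y _ <-]; case/andP: (G01 y).
Qed.

Lemma right_reg_le x y : x < y -> right_reg x <= G y.
Proof.
move=> xy; apply: ge_inf; first exact: (has_inf_G x).2.
by exists y => //=; rewrite in_itv/= andbT.
Qed.

Lemma le_right_reg x : G x <= right_reg x.
Proof.
apply: lb_le_inf; first exact: (has_inf_G x).1.
by move=> _ [y + <-]; rewrite /= in_itv/= andbT => xy; apply: Gnd; exact: ltW.
Qed.

Lemma right_reg_nd : {homo right_reg : x y / x <= y}.
Proof.
move=> x y xy; apply: lb_le_inf; first exact: (has_inf_G y).1.
move=> _ [z + <-]; rewrite /= in_itv/= andbT => yz; apply: right_reg_le.
exact: le_lt_trans yz.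
Qed.

Lemma right_reg_continuous : right_continuous right_reg.
Proof.
move=> x; apply/cvgrPdist_le => e e0.
have [_ [y + <-] Gy] := inf_adherent e0 (has_inf_G x).
rewrite /= in_itv/= andbT => xy.
near=> z; have xz : x < z by near: z; exact: nbhs_right_gt.
have zy : z < y by near: z; exact: nbhs_right_lt.
rewrite distrC ger0_norm ?subr_ge0 ?right_reg_nd ?(ltW xz)//.
rewrite lerBlDr addrC; apply: (le_trans (right_reg_le zy)); exact: ltW.
Unshelve. all: by end_near. Qed.

End right_regularization.

Lemma abel_sum (R : comNzRingType) (f D : nat -> R) k :
  \sum_(i < k) f i * (D i.+1 - D i) =
  f k * D k - f 0%N * D 0%N - \sum_(i < k) (f i.+1 - f i) * D i.+1.
Proof.
elim: k => [|k ih]; first by rewrite !big_ord0 subr0 subrr.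
by rewrite !big_ord_recr/= ih; ring.
Qed.

Lemma distfun_lebesgue_stieltjes (R : realType) (H : cumulativeBounded (0:R) (1:R)) x :
  distfun (lebesgue_stieltjes_measure H) x = H x.
Proof.
have := cdf_lebesgue_stieltjes_id H x.
by rewrite /cdf /distribution /pushforward preimage_id /distfun => ->.
Qed.

Section helly.
Context {R : realType} {T : Type} (U : set_system T) (P_ : T -> probR R).
Hypothesis UU : UltraFilter U.
Hypothesis tight : forall e : R, 0 < e -> exists2 A : R, 0 < A &
  \forall n \near U, 1 - e <= distfun (P_ n) A - distfun (P_ n) (- A).

(** Along an ultrafilter every distribution function has a pointwise limit, so
    no diagonal extraction is needed: the right regularization of that limit
    defines the limit measure. In the comparison of Riemann-Stieltjes sums
    the jumps D of the regularization are summable, and summation by parts moves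
    the differences onto the test function. *)
Theorem ultra_prokhorov : exists rho : probR R, forall f : R -> R,
  continuous f -> (exists M, forall x, `|f x| <= M) ->
  (\int[P_ n]_x f x)%R @[n --> U] --> (\int[rho]_x f x)%R.
Proof.
have PU : ProperFilter U by exact: ultra_proper.
have FU : Filter U by exact: filter_filter.
have /choice[G GP] : forall x, exists l : R, distfun (P_ n) x @[n --> U] --> l.
  by move=> x; apply: (@ultra_bounded_cvg _ _ _ _ 0 1) => n;
    rewrite distfun_ge0 distfun_le1.
have Gnd : {homo G : x y / x <= y}.
  move=> x y xy; rewrite -subr_ge0; apply: cvgr_to_ge (cvgB (GP y) (GP x)) _.
  by apply: nearW => n; rewrite subr_ge0; exact: distfun_nd.
have G01 x : 0 <= G x <= 1.
  apply/andP; split.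
    by apply: cvgr_to_ge (GP x) _; apply: nearW => n; exact: distfun_ge0.
  by apply: cvgr_to_le (GP x) _; apply: nearW => n; exact: distfun_le1.
have Gtight e : 0 < e -> exists A : R, [/\ 0 < A, G (- A) <= e, 1 - e <= G A &
    \forall n \near U, 1 - e <= distfun (P_ n) A - distfun (P_ n) (- A)].
  move=> e0; have [A A0 nA] := tight e0; exists A.
  have h : 1 - e <= G A - G (- A).
    exact: cvgr_to_ge (cvgB (GP A) (GP (- A))) nA.
  by have := G01 A; have := G01 (- A); split=> //; lra.
pose H := right_reg G.
have Hnd : nondecreasing H by exact: right_reg_nd.
have Hrc : right_continuous H by exact: right_reg_continuous.
have GH x : G x <= H x by exact: le_right_reg.
have HG x y : x < y -> H x <= G y by exact: right_reg_le.
have H01 x : 0 <= H x <= 1.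
  have := G01 x; have := G01 (x + 1); have := GH x; have := @HG x (x + 1).
  by rewrite ltrDl ltr01 => /(_ isT); lra.
have HN : H @ -oo --> (0 : R).
  apply/cvgrPdist_le => e e0; have [A [A0 GA _ _]] := Gtight _ e0.
  near=> x; rewrite sub0r normrN ger0_norm; last by case/andP: (H01 x).
  have xA : x < - A by near: x; apply: nbhs_ninfty_lt; rewrite num_real.
  exact: le_trans (HG _ _ xA) GA.
have Hy : H @ +oo --> (1 : R).
  apply/cvgrPdist_le => e e0; have [A [A0 _ GA _]] := Gtight _ e0.
  near=> x; rewrite ger0_norm; last by rewrite subr_ge0; case/andP: (H01 x).
  have : A <= x by near: x; apply: nbhs_pinfty_ge; rewrite num_real.
  by move=> /Hnd; have := GH A; lra.
pose Hc : cumulativeBounded (0:R) (1:R) := HB.pack H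
  (isCumulative.Build R _ R H Hnd Hrc) (isCumulativeBounded.Build R 0 1 H HN Hy).
have distfunH x : distfun (lebesgue_stieltjes_measure Hc) x = H x.
  by rewrite distfun_lebesgue_stieltjes.
exists (lebesgue_stieltjes_measure Hc : probR R) => f cf [M fM].
have M0 : 0 <= M by apply: le_trans (fM 0).
apply/cvgrPdist_le => d d0.
pose e := d / (6 * (M + 1)).
have e0 : 0 < e by rewrite divr_gt0// mulr_gt0// ltr_wpDl.
have [A [A0 GNA GA nA]] := Gtight _ e0.
have ab : - A - 1 < A + 1 by lra.
have [k [p [p0 pk pinc fp approx]]] := stieltjes_approx cf fM ab e0.
pose S (F : R -> R) := \sum_(i < k) f (p i) * (F (p i.+1) - F (p i)).
have SG : S (distfun (P_ n)) @[n --> U] --> S G.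
  apply: cvg_big => [|i _]; first exact: add_continuous.
  apply: cvgM; first exact: cvg_cst.
  by apply: cvgB; exact: GP.
have HNA : H (p 0%N) <= e by rewrite p0; apply: le_trans (HG _ _ _) GNA; lra.
have GpA : 1 - e <= G (p k) by rewrite pk; apply: le_trans GA (Gnd _ _ _); lra.
have SGH : `|S H - S G| <= e + 2 * (M * e).
  pose D x := H x - G x.
  have D0 x : 0 <= D x by rewrite subr_ge0.
  have -> : S H - S G = \sum_(i < k) f (p i) * (D (p i.+1) - D (p i)).
    by rewrite /S -sumrB; apply: eq_bigr => i _; rewrite /D; ring.
  rewrite (abel_sum (f \o p) (D \o p))/=.
  have DK : `|f (p k) * D (p k)| <= M * e.
    rewrite normrM ler_pM// ger0_norm//.
    by rewrite /D; have := H01 (p k); lra.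
  have DZ : `|f (p 0%N) * D (p 0%N)| <= M * e.
    rewrite normrM ler_pM// ger0_norm//.
    by rewrite /D; have := G01 (p 0%N); lra.
  have DS : `|\sum_(i < k) (f (p i.+1) - f (p i)) * D (p i.+1)| <= e.
    rewrite (le_trans (ler_norm_sum _ _ _))//.
    apply: (@le_trans _ _ (\sum_(i < k) e * (G (p i.+2) - G (p i.+1)))).
      apply: ler_sum => i _; rewrite normrM ler_pM//.
        by rewrite distrC fp.
      by rewrite ger0_norm// lerD2r HG// pinc.
    rewrite -mulr_sumr ler_piMr ?(ltW e0)//.
    rewrite -(big_mkord xpredT (fun i => G (p i.+2) - G (p i.+1))).
    rewrite (telescope_sumr (fun i => G (p i.+1)))//.
    by have := G01 (p k.+1); have := G01 (p 1%N); lra.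
  rewrite (le_trans (ler_normB _ _))//.
  have := ler_normB (f (p k) * D (p k)) (f (p 0%N) * D (p 0%N)).
  by lra.
have hrho := approx (lebesgue_stieltjes_measure Hc); rewrite !distfunH in hrho.
have {}hrho : `|\int[lebesgue_stieltjes_measure Hc]_x f x - S H| <= e + M * (2 * e).
  apply: le_trans (_ : _ <= e + M * (1 - (H (A + 1) - H (- A - 1)))) _.
    by move: hrho; under eq_bigr do rewrite !distfunH.
  rewrite lerD2l ler_wpM2l//; have := GH (A + 1).
  by rewrite -pk; rewrite p0 in HNA; lra.
near=> n.
have hn := approx (P_ n).
have {}hn : `|\int[P_ n]_x f x - S (distfun (P_ n))| <= e + M * e.
  apply: le_trans hn _; rewrite lerD2l ler_wpM2l//.
  have h : 1 - e <= distfun (P_ n) A - distfun (P_ n) (- A) by near: n.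
  have := @distfun_nd _ (P_ n) A (A + 1); have := @distfun_nd _ (P_ n) (- A - 1) (- A).
  by rewrite lerDl ler01 gerDl lerN10 => /(_ isT) h1 /(_ isT) h2; lra.
have hS : `|S G - S (distfun (P_ n))| <= e.
  by near: n; move/cvgrPdist_le : SG; apply.
rewrite (_ : _ - _ = (\int[lebesgue_stieltjes_measure Hc]_x f x - S H) +
   (S H - S G) + (S G - S (distfun (P_ n))) - (\int[P_ n]_x f x - S (distfun (P_ n))));
  last by ring.
rewrite (le_trans (ler_normB _ _))//.
have := ler_normD ((\int[lebesgue_stieltjes_measure Hc]_x f x - S H) + (S H - S G))
  (S G - S (distfun (P_ n))).
have := ler_normD (\int[lebesgue_stieltjes_measure Hc]_x f x - S H) (S H - S G).
have dE : d = 6 * (M * e) + 6 * e.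
  have M1 : M + 1 != 0 by rewrite gt_eqF// ltr_wpDl.
  by rewrite /e; field.
have : 0 <= M * e by rewrite mulr_ge0// ltW.
by rewrite dE; lra.
Unshelve. all: by end_near. Qed.

End helly.

(** * Uniqueness of analytic continuation for Cauchy transforms *)

Section identity_principle.
Context {R : realType}.
Variables (P Q : probR R) (z0 : R[i]).
Hypothesis z0_gt0 : 0 < Im z0.
Let b := Im z0.

Let u (n : nat) (h : R[i]) (x : R) := (z0 - x%:C)^-1 ^+ n * (z0 + h - x%:C)^-1.

Lemma Im_near (h : R[i]) : normc h < b -> 0 < Im (z0 + h).
Proof.
move=> hb; rewrite Im_addc; have := normc_Im h; rewrite ler_norml.
by rewrite -/b; lra.
Qed.

Let u_cont n h : normc h < b -> ccontinuous (u n h).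
Proof.
move=> hb; apply: ccontinuousM; first exact/ccontinuousX/resolvent_continuous.
exact/resolvent_continuous/Im_near.
Qed.

Let normc_u n h x : normc h < b -> normc (u n h x) <= b^-1 ^+ n * (Im (z0 + h))^-1.
Proof.
move=> hb; rewrite normcM normcX ler_pM ?exprn_ge0 ?normc_ge0//.
  by rewrite lerXn2r ?nnegrE ?normc_ge0 ?invr_ge0 ?(ltW z0_gt0)// normc_resolvent.
by rewrite normc_resolvent// Im_near.
Qed.

Let u_int (M : probR R) n h : normc h < b -> cintegrable M setT (u n h).
Proof.
move=> hb; apply: cbounded_cintegrable; first exact: u_cont.
by eexists => x; exact: normc_u.
Qed.

Let a (M : probR R) n := cintegral M setT (fun x => (z0 - x%:C)^-1 ^+ n.+1).
Let r (M : probR R) n h := cintegral M setT (u n h).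

(** One step of the expansion of the resolvent at z0 + h in powers of h. *)
Let r_step M n h : normc h < b -> r M n h = a M n - h * r M n.+1 h.
Proof.
move=> hb; rewrite /r /a -cintegralZ//; last exact: u_int.
have aint : cintegrable M setT (fun x => (z0 - x%:C)^-1 ^+ n.+1).
  apply: cbounded_cintegrable; first exact/ccontinuousX/resolvent_continuous.
  exact/cboundedX/resolvent_bounded.
rewrite -cintegralB//; last by apply: cintegrableZ => //; exact: u_int.
apply: eq_cintegral => x _; rewrite /u exprS.
have h1 : z0 - x%:C != 0 by exact: resolvent_neq0.
have h2 : z0 + h - x%:C != 0 by apply: resolvent_neq0; exact: Im_near.
move: (_ ^+ n) => v; field; by rewrite h1 h2.
Qed.

Let normc_r M n h : normc h < b -> normc (r M n h) <= b^-1 ^+ n * (Im (z0 + h))^-1.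
Proof.
move=> hb; apply: normc_cintegral_le; first exact: u_cont.
by move=> x; exact: normc_u.
Qed.

Let G0 M h : cauchy_transform M (z0 + h) = r M 0%N h.
Proof. by apply: eq_cintegral => x _; rewrite /u expr0 mul1r. Qed.

Hypothesis clustering : forall e : R, 0 < e -> exists2 h : R[i],
  h != 0 /\ normc h < e &
  cauchy_transform P (z0 + h) = cauchy_transform Q (z0 + h).

(** The Taylor coefficients at z0 are determined one after the other by the
    values at points tending to z0; once they all agree, the two remainders of
    order n decay geometrically in the disc of radius Im z0. *)
Lemma cauchy_transform_identity (h : R[i]) : normc h < b ->
  cauchy_transform P (z0 + h) = cauchy_transform Q (z0 + h).
Proof.
pose good h := [/\ h != 0, normc h < b & r P 0%N h = r Q 0%N h].
have step n : (forall h, good h -> r P n h = r Q n h) -> a P n = a Q n.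
  move=> rE; apply/eqP; rewrite -subr_eq0 -normc_eq0; apply/eqP/le_anti.
  rewrite normc_ge0 andbT; apply/ler_addgt0Pr => e e0; rewrite add0r.
  pose C := 4 * b^-1 ^+ n.+2.
  have C0 : 0 < C by rewrite mulr_gt0// exprn_gt0// invr_gt0.
  have d0 : 0 < Num.min (b / 2) (e / C).
    by rewrite lt_min !divr_gt0.
  have [k [k0]] := clustering d0; rewrite lt_min => /andP[kb ke].
  rewrite !G0 => k0E.
  have kb' : normc k < b by have := z0_gt0; rewrite -/b; lra.
  have aE M : a M n = r M n k + k * r M n.+1 k by rewrite r_step// subrK.
  rewrite !aE (rE k (And3 k0 kb' k0E)) opprD addrACA subrr add0r -mulrBr normcM.
  have b20 : 0 < b / 2 by rewrite divr_gt0.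
  have Imk : (Im (z0 + k))^-1 <= 2 * b^-1.
    rewrite -[2]invrK -invfM lef_pV2 ?posrE ?Im_near// 1?mulrC//.
    rewrite Im_addc; have := normc_Im k; rewrite ler_norml -/b; lra.
  have rC M : normc (r M n.+1 k) <= C / 2.
    rewrite (le_trans (normc_r _ _ kb'))//.
    rewrite (_ : C / 2 = b^-1 ^+ n.+1 * (2 * b^-1)); last first.
      by rewrite /C exprSr; move: (_ ^+ n.+1) => X; move: b^-1 => Y; field.
    by rewrite ler_wpM2l// exprn_ge0// invr_ge0 ltW.
  rewrite (@le_trans _ _ (normc k * C))//.
    rewrite ler_wpM2l ?normc_ge0// (le_trans (normcD _ _))// normc_opp.
    by have := rC P; have := rC Q; lra.
  by rewrite -ler_pdivlMr// ltW.
have rE n : forall h, good h -> r P n h = r Q n h.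
  elim: n => [h1 []//|n ih k gk]; have [k0 kb _] := gk.
  apply: (mulfI k0); have := ih k gk; rewrite (r_step P n)// (r_step Q n)// (step n ih).
  by move/addrI/oppr_inj.
move=> hb; rewrite !G0; apply/eqP; rewrite -subr_eq0 -normc_eq0; apply/eqP/le_anti.
rewrite normc_ge0 andbT.
have E n : r P 0%N h - r Q 0%N h = (- h) ^+ n * (r P n h - r Q n h).
  elim: n => [|n ->]; first by rewrite expr0 mul1r.
  by rewrite (r_step P n)// (r_step Q n)// (step n (rE n)) exprSr; ring.
have xb : `|normc h / b| < 1.
  by rewrite ger0_norm ?divr_ge0 ?normc_ge0 ?(ltW z0_gt0)// ltr_pdivrMr// mul1r.
have lim0 : (2 * (Im (z0 + h))^-1) * (normc h / b) ^+ n @[n --> \oo] --> (0 : R).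
  rewrite -[X in _ --> X](mulr0 (2 * (Im (z0 + h))^-1)).
  by apply: cvgM; [exact: cvg_cst|exact: cvg_expr].
apply: cvgr_to_ge lim0 _; apply: nearW => n.
rewrite (E n) normcM normcX normc_opp expr_div_n -exprVn.
rewrite (_ : _ * (normc h ^+ n * _) =
  normc h ^+ n * (2 * (b^-1 ^+ n * (Im (z0 + h))^-1))); last by ring.
rewrite ler_wpM2l ?exprn_ge0 ?normc_ge0// (le_trans (normcD _ _))// normc_opp.
by have := normc_r P n hb; have := normc_r Q n hb; lra.
Qed.

End identity_principle.

(** * Stieltjes inversion *)

Section stieltjes_inversion.
Context {R : realType}.
Implicit Types (P Q : probR R).

Lemma bounded_convergence P (f_ : nat -> R -> R) (f : R -> R) (M : R) :
  (forall n, measurable_fun setT (f_ n : measurableTypeR R -> R)) ->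
  measurable_fun setT (f : measurableTypeR R -> R) ->
  (forall n x, `|f_ n x| <= M) -> (forall x, f_ n x @[n --> \oo] --> f x) ->
  \int[P]_x f_ n x @[n --> \oo] --> \int[P]_x f x.
Proof.
move=> mf_ mf fM ff.
have iM : P.-integrable setT (EFin \o cst M).
  apply: bounded_continuous_integrable; first by move=> x; exact: cvg_cst.
  by exists `|M|.
have mf_' n : measurable_fun setT (fun x : measurableTypeR R => (f_ n x)%:E).
  exact/measurable_EFinP.
have mf' : measurable_fun setT (fun x : measurableTypeR R => (f x)%:E).
  exact/measurable_EFinP.
have ae1 : {ae P, forall x, setT x -> (f_ n x)%:E @[n --> \oo] --> (f x)%:E}.
  by apply: aeW => x _; apply: cvg_EFin; [apply: nearW => n|exact: ff].
have ae2 : {ae P, forall x n, setT x -> (`|(f_ n x)%:E| <= (EFin \o cst M) x)%E}.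
  by apply: aeW => x n _; rewrite lee_fin fM.
have [fi _ h] := dominated_convergence measurableT mf_' mf' ae1 iM ae2.
apply: fine_cvg; rewrite fineK//; exact: integrable_fin_num.
Qed.

Lemma abs_atan (x : R) : `|atan x| <= pi / 2.
Proof. by rewrite ler_norml !ltW ?atan_gtNpi2 ?atan_ltpi2. Qed.

(** Up to an affine change, the distribution function of P smoothed by the Cauchy
    law of scale 1 / k, since arctan is a primitive of the Poisson kernel. *)
Definition atan_smooth P (k q : R) : R := \int[P]_x atan (k * (q - x)).

Let atan_cont (k q : R) : continuous (fun x : R => atan (k * (q - x))).
Proof.
move=> x; apply: (@continuous_comp _ _ _ (fun x => k * (q - x)) atan); last exact: continuous_atan.
by apply: cvgM; [exact: cvg_cst|apply: cvgB; [exact: cvg_cst|exact: cvg_id]].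
Qed.

Lemma atan_smooth_derive P (k q : R) : 0 < k ->
  is_derive q 1 (atan_smooth P k) (- Im (cauchy_transform P (q +i* k^-1))).
Proof.
move=> k0.
have dq x (s : R) : is_derive s 1 (fun s => atan (k * (s - x)))
    (k * (1 + (k * (s - x)) ^+ 2)^-1).
  have h : is_derive s 1 (fun s => k * (s - x)) k.
    by apply: is_derive_eq; rewrite /GRing.scale/=; ring.
  have := @is_derive1_comp _ atan (fun s => k * (s - x)) s _ _ _ h.
  by move=> /(_ _ (is_derive1_atan _)); rewrite mulrC.
have pE (s x : R) : partial1of2 (fun s x => atan (k * (s - x))) s x =
    k * (1 + (k * (s - x)) ^+ 2)^-1.
  by rewrite partial1of2E; apply: derive_val.
have ki : P.-integrable setT (EFin \o cst k).
  apply: bounded_continuous_integrable; first by move=> x; exact: cvg_cst.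
  by exists `|k|.
have qI : `]q - 1, q + 1[%classic q by rewrite /= in_itv/=; lra.
have fi s : `]q - 1, q + 1[%classic s ->
    P.-integrable setT (EFin \o (fun x => atan (k * (s - x)))).
  move=> _; apply: bounded_continuous_integrable; first exact: atan_cont.
  by exists (pi / 2) => x; exact: abs_atan.
have fd s (x : R) : `]q - 1, q + 1[%classic s -> [set: R] x ->
    derivable (fun s => atan (k * (s - x))) s 1.
  by move=> _ _; have [] := dq x s.
have fb s (x : R) : `]q - 1, q + 1[%classic s -> [set: R] x ->
    `|partial1of2 (fun s x => atan (k * (s - x))) s x| <= cst k x.
  move=> _ _; rewrite pE ger0_norm; last first.
    by rewrite mulr_ge0 ?(ltW k0)// invr_ge0 addr_ge0// sqr_ge0.
  rewrite ler_piMr ?(ltW k0)// invf_le1; first by rewrite lerDl sqr_ge0.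
  by rewrite ltr_wpDr// sqr_ge0.
split.
  exact: (derivable_under_integral measurableT qI fi fd (fun=> ltW k0) ki fb).
rewrite -derive1E.
rewrite (differentiation_under_integral measurableT qI fi fd (fun=> ltW k0) ki fb).
have -> : Im (cauchy_transform P (q +i* k^-1)) =
  \int[P]_x Im ((q +i* k^-1) - x%:C)^-1 by [].
rewrite -mulN1r -RintegralZl//; last first.
  by apply: (resolvent_integrable P _).2; rewrite /= invr_gt0.
apply: eq_Rintegral => x _; rewrite pE mulN1r Im_invc !ReImE/=.
have k1 : k != 0 by rewrite gt_eqF.
have h1 : 1 + (k * (q - x)) ^+ 2 != 0 by rewrite gt_eqF// ltr_wpDr// sqr_ge0.
have h2 : (q + - x) ^+ 2 + (k^-1 + - 0) ^+ 2 != 0.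
  by rewrite oppr0 addr0 gt_eqF// ltr_wpDl ?sqr_ge0// exprn_gt0// invr_gt0.
have h3 : 1 + (k * (q - x)) ^+ 2 = k ^+ 2 * ((q + - x) ^+ 2 + (k^-1 + - 0) ^+ 2).
  by field.
rewrite h3; move: h2; move: (_ + _ ^+ 2) => D D0; field; by rewrite D0 k1.
Qed.

Let cvg_atan_mul (c : R) : 0 < c -> atan (n%:R * c) @[n --> \oo] --> (pi / 2 : R).
Proof.
move=> c0; have h : (n%:R * c : R) @[n --> \oo] --> +oo.
  apply/cvgryPge => A; near=> n; rewrite -ler_pdivrMr//.
  by near: n; exact: nbhs_infty_ger.
exact: (cvg_comp _ _ h (@cvgy_atan R)).
Unshelve. all: by end_near. Qed.

Let lfun P (q : R) := fine (P `]-oo, q[%classic).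

(** Scaling the arctangent to a jump recovers the distribution function up to
    the mean of its left and right values. *)
Lemma atan_smooth_cvg P q :
  atan_smooth P n%:R q @[n --> \oo] --> pi / 2 * (distfun P q + lfun P q - 1).
Proof.
pose s (x : R) : R := \1_(`]-oo, q]%classic) x + \1_(`]-oo, q[%classic) x - 1.
have i1 : P.-integrable setT (EFin \o (\1_(`]-oo, q]%classic) : R -> R)).
  exact: integrable_indic.
have i2 : P.-integrable setT (EFin \o (\1_(`]-oo, q[%classic) : R -> R)).
  exact: integrable_indic.
have i3 : P.-integrable setT (EFin \o (cst 1 : R -> R)).
  apply: bounded_continuous_integrable; first by move=> x; exact: cvg_cst.
  by exists `|1|.
have i12 : P.-integrable setT
    (EFin \o (fun x : R => \1_(`]-oo, q]%classic) x + \1_(`]-oo, q[%classic) x : R)).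
  exact: (integrableD measurableT i1 i2).
have i123 : P.-integrable setT (EFin \o s).
  exact: (integrableB measurableT i12 i3).
have -> : pi / 2 * (distfun P q + lfun P q - 1) = \int[P]_x (pi / 2 * s x).
  rewrite RintegralZl//; congr (_ * _).
  rewrite RintegralB// RintegralD// Rintegral_cst//= probability_setT/= mulr1.
  by rewrite /Rintegral !integral_indic// !setIT.
apply: (@bounded_convergence P (fun n x => atan (n%:R * (q - x))) _ (pi / 2)).
- by move=> n; apply: continuous_measurable_fun; exact: atan_cont.
- apply: measurable_funM => //; apply: measurable_funB => //.
  by apply: measurable_funD; exact: measurable_indic.
- by move=> n x; exact: abs_atan.
move=> x; rewrite /s !indicE !mem_setE !in_itv/=.
have [xq|qx|->] := ltgtP x q.
- rewrite /= -addrA subrr addr0 mulr1; apply: cvg_atan_mul; lra.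
- rewrite /= add0r sub0r mulrN1.
  under eq_fun do rewrite -opprB mulrN atanN.
  by apply: cvgN; apply: cvg_atan_mul; lra.
- under eq_fun do rewrite subrr mulr0 atan0.
  rewrite /= addr0 subrr mulr0.
  exact: cvg_cst.
Qed.

Lemma atan_smooth_Ny P (k : R) : 0 < k ->
  atan_smooth P k (- n%:R) @[n --> \oo] --> - (pi / 2 : R).
Proof.
move=> k0.
have -> : - (pi / 2) = \int[P]_x (cst (- (pi / 2)) x).
  by rewrite Rintegral_cst//= probability_setT/= mulr1.
apply: (@bounded_convergence P (fun n x => atan (k * (- n%:R - x))) _ (pi / 2)) => //.
- by move=> n; apply: continuous_measurable_fun; exact: atan_cont.
- by move=> n x; exact: abs_atan.
move=> x; under eq_fun do rewrite -opprD mulrN atanN; apply: cvgN.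
have h : (k * (n%:R + x) : R) @[n --> \oo] --> +oo.
  apply/cvgryPge => A; near=> n; rewrite -ler_pdivrMl// -lerBlDr.
  by near: n; exact: nbhs_infty_ger.
exact: (cvg_comp _ _ h (@cvgy_atan R)).
Unshelve. all: by end_near. Qed.

Lemma distfun_right_continuous P : right_continuous (distfun P).
Proof.
pose X : {RV P >-> R} := HB.pack (idfun : measurableTypeR R -> R)
  (@isMeasurableFun.Build _ _ _ _ (idfun : measurableTypeR R -> R)
    (@measurable_id _ _ setT)).
have XE r : cdf X r = P `]-oo, r]%classic.
  by rewrite /cdf /distribution /pushforward preimage_id.
move=> a; apply: fine_cvg; rewrite fineK ?fin_num_measure// -XE.
by under eq_fun do rewrite -XE; exact: cdf_right_continuous.
Qed.

(** On a horizontal line, minus the imaginary part of the Cauchy transform is the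
    derivative of the smoothed distribution function; the constant of integration
    is fixed at minus infinity, and removing the smoothing determines the mean of
    the two one-sided limits of the distribution function, hence the function
    itself by right continuity. *)
Theorem distfun_cauchy_transform P Q :
  (forall z, 0 < Im z -> cauchy_transform P z = cauchy_transform Q z) ->
  distfun P =1 distfun Q.
Proof.
move=> PQ.
have smoothE (k q : R) : 0 < k -> atan_smooth P k q = atan_smooth Q k q.
  move=> k0; pose D s := atan_smooth P k s - atan_smooth Q k s.
  have dD (s : R) : is_derive s 1 D 0.
    have hP := @atan_smooth_derive P k s k0; have hQ := @atan_smooth_derive Q k s k0.
    by apply: is_derive_eq; rewrite PQ ?subrr//= invr_gt0.
  apply/eqP; rewrite -subr_eq0; apply/eqP.
  have DE n : D (- n%:R) = D q by apply: is_derive_0_is_cst.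
  have : D (- n%:R) @[n --> \oo] --> (0 : R).
    rewrite -(subrr (- (pi / 2 : R))); apply: cvgB; exact: atan_smooth_Ny.
  under eq_fun do rewrite DE.
  by move/(cvg_lim (@Rhausdorff R)); rewrite lim_cst.
have meanE q : distfun P q + lfun P q = distfun Q q + lfun Q q.
  have hP := @atan_smooth_cvg P q; have hQ := @atan_smooth_cvg Q q.
  have pi2 : pi / 2 != 0 :> R by rewrite gt_eqF// divr_gt0// pi_gt0.
  apply: (addIr (- 1)); apply: (mulfI pi2).
  apply: (@cvg_unique _ (@Rhausdorff R) _ _ _ _ hP).
  apply: cvg_trans hQ; apply: near_eq_cvg; near=> n; apply/esym/smoothE.
  by rewrite ltr0n; near: n; exact: nbhs_infty_gt.
have lfun_le M q : lfun M q <= distfun M q.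
  apply: fine_le; rewrite ?fin_num_measure// le_measure ?inE//.
  by apply: subset_itvl; rewrite bnd_simp.
have distfun_le M q q' : q < q' -> distfun M q <= lfun M q'.
  by move=> qq'; apply: fine_le; rewrite ?fin_num_measure// le_measure ?inE//;
    apply: subset_itvl; rewrite bnd_simp.
have le_PQ (M N : probR R) q : (forall q, distfun M q + lfun M q = distfun N q + lfun N q) ->
    distfun M q <= distfun N q.
  move=> MN; apply: (cvgr_to_ge (@distfun_right_continuous N q)); near=> q'.
  have qq' : q < q' by near: q'; exact: nbhs_right_gt.
  have := distfun_le M _ _ qq'; have := lfun_le N q'; have := MN q'.
  by have := distfun_nd M (ltW qq'); lra.
by move=> q; apply/le_anti; rewrite !le_PQ.
Unshelve. all: by end_near. Qed.

(** Half-open intervals generate the Borel sets, and the Lebesgue-Stieltjes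
    measure is the unique measure with prescribed values on them. *)
Lemma distfun_inj P Q : distfun P =1 distfun Q -> forall A, measurable A -> P A = Q A.
Proof.
move=> PQ.
have [H HE] : exists H : cumulative R R, (H : R -> R) = distfun P.
  pose H : cumulative R R := HB.pack (distfun P)
    (isCumulative.Build R _ R (distfun P) (@distfun_nd _ P) (@distfun_right_continuous P)).
  by exists H.
have HM (M : probR R) : distfun M =1 distfun P ->
    forall A, measurable A -> lebesgue_stieltjes_measure H A = M A.
  move=> MP; apply: lebesgue_stieltjes_measure_unique => I [[a b]] /= _ <-.
  rewrite /lebesgue_stieltjes_measure /measure_extension/=.
  rewrite measurable_mu_extE/=; last exact: is_ocitv.
  have [ab|ba] := leP a b; last first.
    by rewrite set_itv_ge ?wlength0 ?measure0// bnd_simp -leNgt ltW.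
  rewrite wlength_itv_bnd//= HE -!MP -distfun_itv// fineK//.
  exact: fin_num_measure.
by move=> A mA; rewrite -(HM P)// -(HM Q).
Qed.

End stieltjes_inversion.

(** * The semicircle law in angular coordinates *)

Section semicircle_integral.
Context {R : realType}.
Local Notation mu := (@lebesgue_measure R).

Lemma semicircle_dominates (r : R) : 0 < r -> semicircle r `<< mu.
Proof.
move=> r0; apply/null_content_dominatesP => A mA A0.
rewrite /semicircle r0; apply: null_set_integral => //.
by apply/measurable_EFinP/measurable_funTS; exact: measurable_semicircle_pdf.
Qed.

Lemma integral_semicircle (r : R) (f : measurableTypeR R -> \bar R) : 0 < r ->
  (semicircle r).-integrable setT f ->
  (\int[semicircle r]_x f x = \int[mu]_x (f x * (semicircle_pdf r x)%:E))%E.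
Proof.
move=> r0 fi; have dom := semicircle_dominates r0.
rewrite -(Radon_Nikodym_change_of_variables dom measurableT fi).
have mf := measurable_int _ fi.
have mpdf : measurable_fun setT (fun x : R => (semicircle_pdf r x)%:E).
  by apply/measurable_EFinP; exact: measurable_semicircle_pdf.
apply: ae_eq_integral => //.
- apply: emeasurable_funM; first exact: mf.
  apply: (measurable_int mu).
  by apply: Radon_Nikodym_integrable; exact: dom.
- exact: emeasurable_funM.
- apply: ae_eqe_mul2l => /=; rewrite Radon_NikodymE/=.
  case: cid => /= h [h1 h2 h3]; apply: integral_ae_eq => //=.
  by move=> A _ mA; rewrite -h3//= /semicircle r0.
Qed.

(** With x = r cos a the density of the semicircle law becomes a squared sine,
    which removes the square root. *)
Lemma Rintegral_semicircle (r : R) (f : R -> R) : 0 < r ->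
  continuous f -> (exists M, forall x, `|f x| <= M) ->
  \int[semicircle r]_x f x =
  \int[mu]_(x in `[0, pi]) (2 / pi * sin x ^+ 2 * f (r * cos x)).
Proof.
move=> r0 cf bf; have pi0 : 0 < pi :> R := pi_gt0 R.
have fi := bounded_continuous_integrable (semicircle r) cf bf.
rewrite /Rintegral integral_semicircle//; congr fine.
pose G (x : R) := 2 / (pi * r ^+ 2) * Num.sqrt (r ^+ 2 - x ^+ 2) * f x.
pose F (x : R) := r * cos x.
transitivity (\int[mu]_(x in `[F pi, F 0%R]) (G x)%:E)%E.
  rewrite /F cospi cos0 mulrN mulr1 [RHS]integral_mkcond/=.
  apply: eq_integral => x _; rewrite patchE /semicircle_pdf ler_norml.
  rewrite mem_setE in_itv/=; case: ifP => _; last by rewrite mule0.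
  by rewrite -EFinM mulrC.
have dF (x : R) : is_derive x 1 F (- (r * sin x)).
  by apply: is_derive_eq; rewrite /GRing.scale/=; ring.
have F'E : derive1 F = (fun x => - (r * sin x)).
  by apply/funext => x; rewrite derive1E; apply: derive_val.
have cF' : continuous (fun x : R => - (r * sin x)).
  by move=> x; apply: cvgN; apply: cvgM; [exact: cvg_cst|exact: continuous_sin].
have cF : continuous F.
  by move=> x; apply: cvgM; [exact: cvg_cst|exact: continuous_cos].
rewrite integration_by_substitution_decreasing.
- apply: eq_integral => x; rewrite inE/= in_itv/= => /andP[x0 xpi].
  rewrite F'E !fctE/= /G /F; congr EFin.
  have s0 : 0 <= sin x by apply: sin_ge0_pi; rewrite x0.
  rewrite (_ : r ^+ 2 - _ = (r * sin x) ^+ 2); last first.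
    by rewrite !exprMn sin2cos2; ring.
  rewrite sqrtr_sqr ger0_norm ?mulr_ge0// ?(ltW r0)//.
  move: (f _) (sin x) => a b; move: pi pi0 => p p0; field.
  by rewrite !gt_eqF.
- exact: ltW.
- by move=> x y xI yI xy; rewrite ltr_pM2l// ltr_cos.
- by rewrite F'E => x _; exact: cF'.
- by rewrite F'E; apply/cvg_ex; eexists; exact/cvg_at_right_filter/cF'.
- by rewrite F'E; apply/cvg_ex; eexists; exact/cvg_at_left_filter/cF'.
- split=> [x _||].
  + by have [] := dF x.
  + exact/cvg_at_right_filter/cF.
  + exact/cvg_at_left_filter/cF.
- apply: continuous_subspaceT => x; apply: cvgM; last exact: cf.
  exact: continuous_semicircle_sqrt.
Qed.

Lemma continuous_integrable_itv (f : R -> R) (a b : R) : continuous f ->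
  mu.-integrable `[a, b] (EFin \o f).
Proof.
move=> cf; apply: continuous_compact_integrable; first exact: segment_compact.
exact: continuous_subspaceT.
Qed.

Lemma ccontinuous_integrable_itv (f : R -> R[i]) (a b : R) : ccontinuous f ->
  cintegrable mu `[a, b] f.
Proof.
by move=> cf; split; apply: continuous_integrable_itv;
  [exact: ccontinuous_Re|exact: ccontinuous_Im].
Qed.

Lemma cauchy_transform_semicircle_angle (r : R) (w : R[i]) : 0 < r -> 0 < Im w ->
  cauchy_transform (semicircle r) w = cintegral mu `[0, pi]
    (fun x => (2 / pi * sin x ^+ 2)%:C * (w - (r * cos x)%:C)^-1).
Proof.
move=> r0 w0; have cf := resolvent_continuous w0.
have [M fM] := resolvent_bounded w0.
apply: complex_ext.
  rewrite [LHS]Rintegral_semicircle//; last 2 first.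
  - exact: ccontinuous_Re cf.
  - by exists M => x; apply: le_trans (fM x); exact: normc_Re.
  by apply: eq_Rintegral => x _; rewrite Re_mulrc.
rewrite [LHS]Rintegral_semicircle//; last 2 first.
- exact: ccontinuous_Im cf.
- by exists M => x; apply: le_trans (fM x); exact: normc_Im.
by apply: eq_Rintegral => x _; rewrite Im_mulrc.
Qed.

End semicircle_integral.

Section sine_orthogonality.
Context {R : realType}.
Local Notation mu := (@lebesgue_measure R).

Lemma sin_natpi n : sin (n%:R * pi) = 0 :> R.
Proof.
elim: n => [|n ih]; first by rewrite mul0r sin0.
by rewrite -natr1 mulrDl mul1r sinDpi ih oppr0.
Qed.

Lemma Rintegral_FTC (f F : R -> R) (a b : R) : a < b -> continuous f ->
  (forall x : R, is_derive x 1 F (f x)) -> \int[mu]_(x in `[a, b]) f x = F b - F a.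
Proof.
move=> ab cf dF; have cF : continuous F.
  move=> x; apply: differentiable_continuous.
  by apply/derivable1_diffP; have [] := dF x.
rewrite /Rintegral (@continuous_FTC2 _ _ F)//.
- exact: continuous_subspaceT.
- split=> [x _||].
  + by have [] := dF x.
  + exact/cvg_at_right_filter/cF.
  + exact/cvg_at_left_filter/cF.
- by move=> x _; rewrite derive1E; apply: derive_val.
Qed.

Let csin (k : R) : continuous (fun x : R => sin (k * x)).
Proof.
move=> x; apply: (@continuous_comp _ _ _ (fun x => k * x) sin); last exact: continuous_sin.
by apply: cvgM; [exact: cvg_cst|exact: cvg_id].
Qed.

Lemma continuous_sin_sin (n : nat) : continuous (fun x : R => sin x * sin (n%:R * x)).
Proof. by move=> x; apply: cvgM; [exact: continuous_sin|exact: csin]. Qed.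

Let dsin (k x : R) : is_derive x 1 (fun x : R => sin (k * x)) (k * cos (k * x)).
Proof.
have h : is_derive x 1 (fun x : R => k * x) k.
  by apply: is_derive_eq; rewrite /GRing.scale/=; ring.
have := @is_derive1_comp _ sin (fun x => k * x) x _ _ _ h.
by move=> /(_ _ (is_derive_sin _)); rewrite mulrC.
Qed.

Lemma Rintegral_sin_sin (n : nat) :
  \int[mu]_(x in `[0, pi]) (sin x * sin (n.+1%:R * x)) = if n == 0%N then pi / 2 else 0 :> R.
Proof.
have pi0 : 0 < pi :> R := pi_gt0 R.
case: n => [|n] /=.
  have d1 (x : R) : is_derive x 1 (fun x => (x - sin x * cos x) / 2)
      (sin x * sin (1 * x)).
    apply: is_derive_eq; rewrite /GRing.scale/= mul1r.
    by have := cos2Dsin2 x; rewrite !expr2; lra.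
  rewrite (Rintegral_FTC pi0 (@continuous_sin_sin 1) d1).
  by rewrite sinpi sin0; ring.
have dn (x : R) : is_derive x 1 (fun x =>
    (sin (n.+1%:R * x) / n.+1%:R - sin (n.+3%:R * x) / n.+3%:R) / 2)
    (sin x * sin (n.+2%:R * x)).
  have d1 := dsin n.+1%:R x; have d3 := dsin n.+3%:R x.
  apply: is_derive_eq; rewrite /GRing.scale/=.
  have -> : n.+1%:R * x = n.+2%:R * x - x by rewrite -[n.+2%:R]natr1; ring.
  have -> : n.+3%:R * x = n.+2%:R * x + x by rewrite -[n.+3%:R]natr1; ring.
  rewrite cosB cosD.
  have h1 : n.+1%:R != 0 :> R by rewrite pnatr_eq0.
  have h3 : n.+3%:R != 0 :> R by rewrite pnatr_eq0.
  move: (n.+1%:R) (n.+3%:R) h1 h3 => a b a0 b0.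
  by field; rewrite a0 b0.
rewrite (Rintegral_FTC pi0 (@continuous_sin_sin n.+2) dn).
by rewrite !sin_natpi !mulr0 sin0; ring.
Qed.

(** Finite form of the generating function of the Chebyshev polynomials of the
    second kind. *)
Lemma chebyshev_generating (s : R[i]) (x : R) N :
  (1 - 2 * s * (cos x)%:C + s ^+ 2) * \sum_(n < N) s ^+ n * (sin (n.+1%:R * x))%:C =
  (sin x)%:C - s ^+ N * (sin (N.+1%:R * x))%:C + s ^+ N.+1 * (sin (N%:R * x))%:C.
Proof.
elim: N => [|N ih].
  by rewrite big_ord0 mulr0 mul0r sin0 mulr0 addr0 expr0 !mul1r subrr.
rewrite big_ord_recr/= mulrDr ih.
have rec : (sin (N.+2%:R * x))%:C =
    2 * (cos x)%:C * (sin (N.+1%:R * x))%:C - (sin (N%:R * x))%:C.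
  have -> : N.+2%:R * x = N.+1%:R * x + x by rewrite -[N.+2%:R]natr1; ring.
  have -> : N%:R * x = N.+1%:R * x - x by rewrite -[N.+1%:R]natr1; ring.
  rewrite sinD sinB !(rmorphD, rmorphB, rmorphM)/=; ring.
by rewrite rec !exprS; ring.
Qed.

End sine_orthogonality.

(** * The Cauchy transform of the semicircle law *)

Section semicircle_transform.
Context {R : realType}.
Local Notation mu := (@lebesgue_measure R).

Lemma cintegral_lin (N : nat) (c : nat -> R[i]) (f : nat -> R -> R) (a b : R) :
  (forall n, continuous (f n)) ->
  cintegral mu `[a, b] (fun x => \sum_(n < N) c n * (f n x)%:C) =
  \sum_(n < N) c n * (\int[mu]_(x in `[a, b]) f n x)%:C.
Proof.
move=> cf; have cfn n : ccontinuous (fun x => c n * (f n x)%:C).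
  by apply: ccontinuousM; [exact: ccontinuous_cst|exact: ccontinuous_real].
elim: N => [|N ih].
  under eq_cintegral => x _ do rewrite big_ord0; rewrite big_ord0.
  by rewrite /cintegral/= !Rintegral_cst//= mul0r.
rewrite big_ord_recr/= -ih; under eq_cintegral => x _ do rewrite big_ord_recr/=.
rewrite cintegralD//; last 2 first.
- by apply: ccontinuous_integrable_itv => x; apply: ccvg_sum => i; exact: cfn.
- exact: ccontinuous_integrable_itv.
congr (_ + _); rewrite cintegralZ//; last first.
  by apply: ccontinuous_integrable_itv; exact: ccontinuous_real.
by congr (_ * _); rewrite /cintegral/= Rintegral_cst//= mul0r.
Qed.

(** The change of variables w = z + t / z uniformizes the semicircle law: with
    x = 2 sqrt t cos a, the resolvent becomes the generating function of the
    Chebyshev polynomials in sqrt t / z, and only its constant term survives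
    the integration against the sine square. *)
Lemma semicircle_cauchy_pos (t : R) (z : R[i]) : 0 < t -> t < normc z ^+ 2 ->
  0 < Im (z + t%:C / z) ->
  cauchy_transform (semicircle (2 * Num.sqrt t)) (z + t%:C / z) = z^-1.
Proof.
move=> t0 tz; set w := z + _ => w0.
set q := Num.sqrt t; have q0 : 0 < q by rewrite sqrtr_gt0.
have qE : t = q ^+ 2 by rewrite sqr_sqrtr// ltW.
have nz0 : 0 < normc z.
  by rewrite lt_neqAle normc_ge0 andbT eq_sym; apply: contraTneq tz => ->;
    rewrite expr0n/= -leNgt ltW.
have z0 : z != 0 by rewrite -normc_gt0.
have pi0 : 0 < pi :> R := pi_gt0 R.
rewrite cauchy_transform_semicircle_angle//; last by rewrite mulr_gt0.
set h := fun x : R => _ : R[i].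
pose s := q%:C / z; pose k := normc s.
have k0 : 0 <= k by exact: normc_ge0.
have k1 : k < 1.
  rewrite /k normcM normcV normcr gtr0_norm// ltr_pdivrMr// mul1r.
  by rewrite -(@ltr_pXn2r _ 2)// ?nnegrE ?normc_ge0 ?(ltW q0)// -qE.
have ch : ccontinuous h.
  apply: ccontinuousM.
    apply: ccontinuous_real => x; apply: cvgM; first exact: cvg_cst.
    by rewrite expr2; under eq_fun do rewrite expr2; apply: cvgM; exact: continuous_sin.
  apply: ccontinuousV => [|x]; last exact: resolvent_neq0.
  apply: ccontinuousB; first exact: ccontinuous_cst.
  by apply: ccontinuous_real => x; apply: cvgM; [exact: cvg_cst|exact: continuous_cos].
pose c n := (2 / pi)%:C * z^-1 * s ^+ n.
pose f (n : nat) (x : R) := sin x * sin (n.+1%:R * x).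
pose S N x := \sum_(n < N) c n * (f n x)%:C.
have cS N : ccontinuous (S N).
  move=> x; apply: ccvg_sum => n; apply: ccvgM; first exact: ccvg_cst.
  by apply: ccvg_real; exact: continuous_sin_sin.
have SE N : cintegral mu `[0, pi] (S N.+1) = z^-1.
  rewrite cintegral_lin; last by move=> n; exact: continuous_sin_sin.
  rewrite big_ord_recl/= big1 ?addr0 => [|n _].
    rewrite Rintegral_sin_sin/= /c expr0 mulr1 mulrAC -rmorphM/=.
    rewrite (_ : 2 / pi * (pi / 2) = 1) ?mul1r//.
    by move: pi pi0 => p p0; field; rewrite gt_eqF.
  by rewrite Rintegral_sin_sin/= mulr0.
pose K : R := 4 / pi / Im w.
have diff N x : normc (h x - S N x) <= K * k ^+ N.
  have D0 : w - (2 * q * cos x)%:C != 0 by exact: resolvent_neq0.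
  have DE : w - (2 * q * cos x)%:C = z * (1 - 2 * s * (cos x)%:C + s ^+ 2).
    rewrite /w /s qE !rmorphM/= rmorph_nat ?rmorphXn/=; move: (q%:C) (cos x)%:C => a b.
    by field.
  have -> : h x - S N x = (2 / pi * sin x)%:C *
     (s ^+ N * (sin (N.+1%:R * x))%:C - s ^+ N.+1 * (sin (N%:R * x))%:C) *
     (w - (2 * q * cos x)%:C)^-1.
    have -> : S N x = (2 / pi * sin x)%:C * z^-1 *
        \sum_(n < N) s ^+ n * (sin (n.+1%:R * x))%:C.
      rewrite mulr_sumr; apply: eq_bigr => n _; rewrite /c /f !rmorphM/=; ring.
    have hD : h x * (w - (2 * q * cos x)%:C) = (2 / pi * sin x ^+ 2)%:C.
      by rewrite /h mulfVK.
    have SD : (2 / pi * sin x)%:C * z^-1 *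
        (\sum_(n < N) s ^+ n * (sin (n.+1%:R * x))%:C) * (w - (2 * q * cos x)%:C) =
        (2 / pi * sin x)%:C * ((sin x)%:C - s ^+ N * (sin (N.+1%:R * x))%:C
          + s ^+ N.+1 * (sin (N%:R * x))%:C).
      rewrite -chebyshev_generating DE.
      move: (\sum_(n < N) _) (1 - _ + _) (_%:C) => T Q v; field; exact: z0.
    apply: (mulIf D0); rewrite mulfVK// mulrBl hD SD.
    by rewrite expr2 [(_ * (sin x * _))%:C](_ : _ = (2 / pi * sin x)%:C * (sin x)%:C);
      [ring|rewrite -rmorphM/= mulrA].
  have sin1 (y : R) : normc (sin y)%:C <= 1 by rewrite normcr ler_norml sin_geN1 sin_le1.
  rewrite !normcM normcV.
  have -> : K * k ^+ N = 2 / pi * (2 * k ^+ N) * (Im w)^-1 by rewrite /K; ring.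
  rewrite ler_pM ?mulr_ge0 ?invr_ge0 ?normc_ge0//; last first.
    by rewrite lef_pV2 ?posrE ?normc_gt0// normc_resolvent_ge.
  rewrite ler_pM ?normc_ge0//.
    rewrite normcr normrM [`|2 / pi|]ger0_norm ?divr_ge0 ?(ltW pi0)//.
    by rewrite ler_piMr ?divr_ge0 ?(ltW pi0)// ler_norml sin_geN1 sin_le1.
  rewrite (le_trans (normcD _ _))// normc_opp !normcM !normcX -/k.
  have kN : 0 <= k ^+ N by rewrite exprn_ge0.
  have h1 : k ^+ N * normc (sin (N.+1%:R * x))%:C <= k ^+ N by rewrite ler_piMr.
  have h2 : k ^+ N.+1 * normc (sin (N%:R * x))%:C <= k ^+ N.
    rewrite (@le_trans _ _ (k ^+ N.+1))//; first by rewrite ler_piMr// exprn_ge0.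
    by rewrite exprS ler_piMl// ltW.
  lra.
apply/eqP; rewrite -subr_eq0 -normc_eq0; apply/eqP/le_anti; rewrite normc_ge0 andbT.
have lim0 : K * pi * k ^+ n.+1 @[n --> \oo] --> (0 : R).
  rewrite -[X in _ --> X](mulr0 (K * pi)); apply: cvgM; first exact: cvg_cst.
  have := @cvg_expr _ k; rewrite ger0_norm// => /(_ k1).
  by rewrite -cvg_shiftS.
apply: cvgr_to_ge lim0 _; apply: nearW => n.
rewrite -(SE n) -cintegralB//; try exact: ccontinuous_integrable_itv.
apply: (@le_trans _ _ (\int[mu]_(x in `[0, pi]) (K * k ^+ n.+1))).
  apply: normc_cintegral => //.
  - by apply: ccontinuous_integrable_itv; exact: ccontinuousB.
  - by apply: continuous_integrable_itv => x; exact: cvg_cst.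
rewrite Rintegral_cst//= lebesgue_measure_itv/= lte_fin pi0/= subr0.
by rewrite mulrAC.
Qed.

Lemma semicircle_cauchy (t : R) (z : R[i]) : 0 <= t -> t < normc z ^+ 2 ->
  0 < Im (z + t%:C / z) ->
  cauchy_transform (semicircle (2 * Num.sqrt t)) (z + t%:C / z) = z^-1.
Proof.
rewrite le_eqVlt => /predU1P[<-|t0]; last exact: semicircle_cauchy_pos.
rewrite mul0r addr0 => z0 Imz.
have r0 : 2 * Num.sqrt 0 = 0 :> R by rewrite sqrtr0 mulr0.
have intE (f : R -> R) : continuous f -> \int[semicircle (2 * Num.sqrt 0)]_x f x = f 0.
  move=> cf; rewrite /Rintegral.
  rewrite (@eq_measure_integral _ _ _ _ (@dirac _ (measurableTypeR R) 0 R)); last first.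
    by move=> A mA _; rewrite /= /semicircle r0 ltxx.
  rewrite integral_dirac//; last first.
    by apply/measurable_EFinP; exact: continuous_measurable_fun.
  by rewrite diracT mul1e.
have cf := resolvent_continuous Imz.
by apply: complex_ext; rewrite /= intE ?subr0//;
  [exact: ccontinuous_Re|exact: ccontinuous_Im].
Qed.

(** Every w of the upper half plane is z + t / z for a z outside the critical
    circle, so the quadratic equation holds without inverting the map. *)
Lemma semicircle_quadratic (t : R) (w : R[i]) : 0 <= t -> 0 < Im w ->
  let g := cauchy_transform (semicircle (2 * Num.sqrt t)) w in
  t%:C * g ^+ 2 - w * g + 1 = 0.
Proof.
move=> t0 w0 g.
(* z and t / z are the two preimages of w; the one of larger modulus is used *)
have [z [z' [zD zM zz']]] : exists z z' : R[i],
    [/\ z + z' = w, z * z' = t%:C & normc z' <= normc z].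
  pose d := sqrtc (w ^+ 2 - 4 * t%:C).
  have dE : d ^+ 2 = w ^+ 2 - 4 * t%:C by rewrite sqr_sqrtc.
  have D : (w + d) / 2 + (w - d) / 2 = w by field.
  have M : (w + d) / 2 * ((w - d) / 2) = t%:C.
    have -> : (w + d) / 2 * ((w - d) / 2) = (w ^+ 2 - d ^+ 2) / 4 by field.
    by rewrite dE; field.
  have [le|/ltW le] := leP (normc ((w - d) / 2)) (normc ((w + d) / 2)).
    by exists ((w + d) / 2), ((w - d) / 2).
  by exists ((w - d) / 2), ((w + d) / 2); split=> //; [rewrite addrC|rewrite mulrC].
have nM : normc z * normc z' = t by rewrite -normcM zM normcr ger0_norm.
have z0 : z != 0.
  apply: contraTneq w0 => zE; move: zz'; rewrite -zD zE normc0 add0r => zz'.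
  have /eqP : normc z' = 0 by apply/le_anti; rewrite zz' normc_ge0.
  by rewrite normc_eq0 => /eqP ->; rewrite ltxx.
have tz : t < normc z ^+ 2.
  rewrite -nM expr2 ltr_pM2l ?normc_gt0// lt_neqAle zz' andbT.
  apply: contraTneq w0 => nE.
  have z'E : z' = conjc z.
    apply: (mulfI z0); rewrite zM -nM nE -expr2 normc_sq.
    by case: (z) => a b; apply: complex_ext; rewrite /= ?expr2; ring.
  by rewrite -zD z'E Im_addc; case: (z) => a b /=; rewrite subrr ltxx.
have z'E : z' = t%:C / z by rewrite -zM mulrAC divff// mul1r.
have wE : w = z + t%:C / z by rewrite -z'E zD.
have gE : g = z^-1 by rewrite /g wE semicircle_cauchy// -wE.
by rewrite gE wE; field; exact: z0.
Qed.

End semicircle_transform.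

(** * Inversion of the reciprocal Cauchy transform near infinity *)

Section complex_fixed_point.
Context {R : realType}.

(** Picard iteration, with the convergence of the real and imaginary parts read
    off a geometric series. *)
Lemma complex_fixed_point (T : R[i] -> R[i]) (z : R[i]) (r k : R) :
  0 <= k < 1 -> 0 <= r ->
  (forall w, normc (w - z) <= r -> normc (T w - z) <= r) ->
  (forall w w', normc (w - z) <= r -> normc (w' - z) <= r ->
     normc (T w - T w') <= k * normc (w - w')) ->
  exists2 w, normc (w - z) <= r & T w = w.
Proof.
move=> /andP[k0 k1] r0 Tr Tk; pose w n := iter n T z.
have wr n : normc (w n - z) <= r.
  by elim: n => [|n ih]; [rewrite subrr normc0|exact: Tr].
pose C := normc (T z - z).
have wk n : normc (w n.+1 - w n) <= C * k ^+ n.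
  elim: n => [|n ih]; first by rewrite expr0 mulr1.
  by rewrite (le_trans (Tk _ _ (wr n.+1) (wr n)))// exprS mulrCA ler_wpM2l.
have C0 : 0 <= C by exact: normc_ge0.
have geo : cvgn (series (geometric C k)).
  by apply: is_cvg_geometric_series; rewrite ger0_norm.
have coord (p : R[i] -> R) : (forall u v, p (u - v) = p u - p v) ->
    (forall u, `|p u| <= normc u) -> cvgn (fun n => p (w n)).
  move=> pB pn; pose a n := p (w n.+1) - p (w n).
  have acv : cvgn (series a).
    apply: normed_cvg; apply: series_le_cvg geo => n //=; last first.
      by rewrite /a -pB (le_trans (pn _)).
    by rewrite mulr_ge0// exprn_ge0.
  have -> : (fun n => p (w n)) = (fun n => series a n + p z).
    apply/funext => n; rewrite /series/= (telescope_sumr (fun n => p (w n)))//.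
    by rewrite subrK.
  by apply: is_cvgD => //; exact: is_cvg_cst.
have cRe : cvgn (fun n => Re (w n)).
  by apply: coord => [u v|u]; [rewrite !ReImE|exact: normc_Re].
have cIm : cvgn (fun n => Im (w n)).
  by apply: coord => [u v|u]; [rewrite !ReImE|exact: normc_Im].
pose l := limn (fun n => Re (w n)) +i* limn (fun n => Im (w n)).
have wl : ccvg \oo w l by split.
have lr : normc (l - z) <= r.
  have wz : normc (w n - z) @[n --> \oo] --> normc (l - z).
    by apply: cvg_normc; apply: ccvgB => //; exact: ccvg_cst.
  apply: cvgr_to_le wz _.
  by apply: nearW.
exists l => //; apply/eqP; rewrite -subr_eq0 -normc_eq0; apply/eqP/le_anti.
rewrite normc_ge0 andbT.
have d0 : normc (w n - l) @[n --> \oo] --> (0 : R) by exact: cvg_normc_sub.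
have d1 : normc (w n.+1 - l) @[n --> \oo] --> (0 : R).
  by move: d0; rewrite -(cvg_shiftS (fun n => normc (w n - l))).
have d : k * normc (w n - l) + normc (w n.+1 - l) @[n --> \oo] --> (0 : R).
  rewrite -[X in _ --> X]addr0 -{1}(mulr0 k); apply: cvgD => //.
  by apply: cvgM => //; exact: cvg_cst.
apply: cvgr_to_ge d _; apply: nearW => n.
rewrite (_ : T l - l = (T l - T (w n)) + (w n.+1 - l)); last by rewrite /w/=; ring.
by rewrite (le_trans (normcD _ _))// lerD// (normcB (w n) l) Tk.
Qed.

End complex_fixed_point.

Section cauchy_inverse.
Context {R : realType} (mu : probR R).
Hypothesis mu1 : mu.-integrable setT (fun x : R => x%:E).
Let G := cauchy_transform mu.
Let m1 := \int[mu]_x `|x|.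
Let L := 100 * (m1 + 1).

Let m1_ge0 : 0 <= m1. Proof. exact: Rintegral_ge0. Qed.
Let L_gt0 : 0 < L. Proof. by rewrite mulr_gt0// ltr_wpDl. Qed.

(** Truncated cone on which the transform is close to that of a point mass; it
    is narrow enough for the resolvents to be bounded uniformly after
    multiplication by the spectral parameter. *)
Definition deep_cone (w : R[i]) := normc w <= 4 * Im w /\ L <= Im w.

Let deep_gt0 w : deep_cone w -> 0 < Im w.
Proof. by case=> _; exact: lt_le_trans. Qed.

Let abs_integrable (k : R) : mu.-integrable setT (EFin \o (fun x : R => k * `|x|)).
Proof.
have h := integrable_norm mu1.
exact: (integrableZl measurableT k h).
Qed.

Let Rintegral_abs (k : R) : \int[mu]_x (k * `|x|) = k * m1.
Proof. by rewrite RintegralZl//; exact: (integrable_norm mu1). Qed.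

Let rint w : 0 < Im w -> cintegrable mu setT (fun x => (w - x%:C)^-1).
Proof. exact: resolvent_integrable. Qed.

Let near1 w (x : R) : 0 < Im w -> normc (w * (w - x%:C)^-1 - 1) <= (Im w)^-1 * `|x|.
Proof.
move=> w0; have d0 := resolvent_neq0 x w0.
have -> : w * (w - x%:C)^-1 - 1 = x%:C * (w - x%:C)^-1 by field.
by rewrite normcM normcr mulrC ler_wpM2r// normc_resolvent.
Qed.

Lemma cauchy_near1 w : 0 < Im w -> normc (w * G w - 1) <= (Im w)^-1 * m1.
Proof.
move=> w0; rewrite -(cintegral_cst mu 1) /G cauchy_transformE -cintegralZ//; last exact: rint.
have i1 : cintegrable mu setT (fun=> (1 : R[i])).
  by apply: cbounded_cintegrable; [exact: ccontinuous_cst|exact: cbounded_cst].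
rewrite -cintegralB//; last by apply: cintegrableZ => //; exact: rint.
rewrite -Rintegral_abs; apply: normc_cintegral => //.
- by apply: cintegrableB => //; apply: cintegrableZ => //; exact: rint.
- by move=> x _; exact: near1.
Qed.

Let K w w' := cintegral mu setT (fun x => (w - x%:C)^-1 * (w' - x%:C)^-1).

Let Kint w w' : 0 < Im w -> 0 < Im w' ->
  cintegrable mu setT (fun x => (w - x%:C)^-1 * (w' - x%:C)^-1).
Proof.
move=> w0 w0'; apply: cbounded_cintegrable.
- by apply: ccontinuousM; exact: resolvent_continuous.
- by apply: cboundedM; exact: resolvent_bounded.
Qed.

Let K_diff w w' : 0 < Im w -> 0 < Im w' -> G w - G w' = (w' - w) * K w w'.
Proof.
move=> w0 w0'; rewrite /K -cintegralZ//; last exact: Kint.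
rewrite /G !cauchy_transformE -cintegralB//; [|exact: rint|exact: rint].
apply: eq_cintegral => x _.
have d0 := resolvent_neq0 x w0; have d0' := resolvent_neq0 x w0'.
by field; rewrite d0 d0'.
Qed.

Let K_near1 w w' : deep_cone w -> deep_cone w' ->
  normc (w * w' * K w w' - 1) <= 5 * L^-1 * m1.
Proof.
move=> dw dw'; have w0 := deep_gt0 dw; have w0' := deep_gt0 dw'.
have i1 : cintegrable mu setT (fun=> (1 : R[i])).
  by apply: cbounded_cintegrable; [exact: ccontinuous_cst|exact: cbounded_cst].
rewrite -(cintegral_cst mu 1) /K -cintegralZ//; last exact: Kint.
rewrite -cintegralB//; last by apply: cintegrableZ => //; exact: Kint.
rewrite -Rintegral_abs; apply: normc_cintegral => //.
  by apply: cintegrableB => //; apply: cintegrableZ => //; exact: Kint.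
move=> x _; set a := w * (w - x%:C)^-1; set b := w' * (w' - x%:C)^-1.
have -> : w * w' * ((w - x%:C)^-1 * (w' - x%:C)^-1) - 1 = a * (b - 1) + (a - 1).
  by rewrite /a /b; ring.
have LV v : deep_cone v -> (Im v)^-1 * `|x| <= L^-1 * `|x|.
  move=> dv; have v0 := deep_gt0 dv; case: dv => _ Lv.
  by rewrite ler_wpM2r// lef_pV2 ?posrE.
have a1 := le_trans (near1 x w0) (LV _ dw).
have b1 := le_trans (near1 x w0') (LV _ dw').
have a4 : normc a <= 4.
  rewrite normcM normcV ler_pdivrMr ?normc_gt0 ?resolvent_neq0//.
  by case: dw => h _; rewrite (le_trans h)// ler_wpM2l// normc_resolvent_ge.
rewrite (le_trans (normcD _ _))// normcM.
have : normc a * normc (b - 1) <= 4 * (L^-1 * `|x|) by rewrite ler_pM ?normc_ge0.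
move: a1; rewrite -!mulrA; lra.
Qed.

Let Lm1 : L^-1 * m1 <= 1 / 100.
Proof. by rewrite mulrC ler_pdivrMr// /L; lra. Qed.

Let cauchy_near w : deep_cone w -> normc (w * G w - 1) <= 1 / 100.
Proof.
move=> dw; have w0 := deep_gt0 dw; apply: le_trans (cauchy_near1 w0) _.
by apply: le_trans Lm1; rewrite ler_wpM2r// lef_pV2 ?posrE//; case: dw.
Qed.

Let normc_near1 (p : R[i]) (e : R) : normc (p - 1) <= e -> 1 - e <= normc p.
Proof.
move=> pe; have := normcD p (1 - p); rewrite (normcB 1).
by rewrite addrC subrK normc1; lra.
Qed.

Lemma cauchy_neq0 w : deep_cone w -> G w != 0.
Proof.
move=> dw; have := normc_near1 (cauchy_near dw).
by apply: contraTneq => ->; rewrite mulr0 normc0 -ltNge; lra.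
Qed.

Let h w := w - (G w)^-1.

Let h_lipschitz w w' : deep_cone w -> deep_cone w' ->
  normc (h w - h w') <= 1 / 4 * normc (w - w').
Proof.
move=> dw dw'; have w0 := deep_gt0 dw; have w0' := deep_gt0 dw'.
have g0 := cauchy_neq0 dw; have g0' := cauchy_neq0 dw'.
have pw := cauchy_near dw; have pw' := cauchy_near dw'.
have kw : normc (w * w' * K w w' - 1) <= 1 / 20.
  by apply: le_trans (K_near1 dw dw') _; move: Lm1; rewrite -mulrA; lra.
have z0 : w != 0 by rewrite Im_neq0.
have z0' : w' != 0 by rewrite Im_neq0.
have e1 : h w - h w' = (w - w') * ((w * G w * (w' * G w') - w * w' * K w w') /
    (w * G w * (w' * G w'))).
  have KE : (w - w') * K w w' = G w' - G w by rewrite -opprB mulNr -K_diff// opprB.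
  have -> : h w - h w' = (w - w') - (G w' - G w) / (G w * G w').
    by rewrite /h; field; rewrite g0 g0'.
  by rewrite -KE; field; rewrite g0 g0' z0 z0'.
rewrite e1 normcM mulrC ler_wpM2r ?normc_ge0// normcM normcV normcM.
move: (w * G w) (w' * G w') (w * w' * K w w') pw pw' kw => p p' k hp hp' hk.
have p1 := normc_near1 hp; have p1' := normc_near1 hp'.
have pp : (1 - 1 / 100) * (1 - 1 / 100) <= normc p * normc p' by rewrite ler_pM//; lra.
rewrite ler_pdivrMr; last by lra.
have -> : p * p' - k = (p - 1) * (p' - 1) + (p - 1) + (p' - 1) - (k - 1) by ring.
have t1 := normcD ((p - 1) * (p' - 1) + (p - 1) + (p' - 1)) (- (k - 1)).
have t2 := normcD ((p - 1) * (p' - 1) + (p - 1)) (p' - 1).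
have t3 := normcD ((p - 1) * (p' - 1)) (p - 1).
have t4 : normc ((p - 1) * (p' - 1)) <= 1 / 100 * (1 / 100).
  by rewrite normcM ler_pM ?normc_ge0.
rewrite normc_opp in t1; lra.
Qed.

(** With a finite first moment the reciprocal transform is a bounded
    perturbation of the identity on the cone. *)
Lemma recip_cauchy_near w : deep_cone w -> normc (w - (G w)^-1) <= 5 * (m1 + 1).
Proof.
move=> dw; have w0 := deep_gt0 dw; have g0 := cauchy_neq0 dw.
have pw := cauchy_near dw; have pw' := cauchy_near1 w0.
have z0 : w != 0 by rewrite Im_neq0.
have -> : w - (G w)^-1 = w * ((w * G w - 1) / (w * G w)) by field; rewrite g0 z0.
have p1 := normc_near1 pw.
rewrite normcM normcM normcV mulrA ler_pdivrMr; last by lra.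
apply: (@le_trans _ _ (4 * Im w * ((Im w)^-1 * m1))).
  by rewrite ler_pM ?normc_ge0//; case: dw.
have -> : 4 * Im w * ((Im w)^-1 * m1) = 4 * m1 by field; rewrite gt_eqF.
have : 5 * (m1 + 1) * (1 - 1 / 100) <= 5 * (m1 + 1) * normc (w * G w).
  by rewrite ler_wpM2l// mulr_ge0// addr_ge0.
have := m1_ge0; lra.
Qed.

(** Being the identity up to a contraction, the reciprocal transform shrinks
    distances at most by the factor 2: its inverses are unique and Lipschitz. *)
Lemma recip_cauchy_lipschitz w w' : deep_cone w -> deep_cone w' ->
  normc (w - w') <= 2 * normc ((G w)^-1 - (G w')^-1).
Proof.
move=> dw dw'; have hl := h_lipschitz dw dw'.
have E : w - w' = ((G w)^-1 - (G w')^-1) + (h w - h w') by rewrite /h; ring.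
have := normcD ((G w)^-1 - (G w')^-1) (h w - h w'); rewrite -E.
by have := normc_ge0 ((G w)^-1 - (G w')^-1); lra.
Qed.

(** The right inverse of the reciprocal transform near a point z solves the
    fixed-point equation w = z + h w, and h is a contraction. *)
Lemma recip_cauchy_surjective z : normc z <= 2 * Im z -> 2 * L <= Im z ->
  exists2 w, normc (w - z) <= 5 * (m1 + 1) & deep_cone w /\ (G w)^-1 = z.
Proof.
move=> zz Lz; set r := 5 * (m1 + 1).
have r0 : 0 <= r by rewrite mulr_ge0// addr_ge0.
have Lr : L = 20 * r by rewrite /L /r; ring.
have deep w : normc (w - z) <= r -> deep_cone w.
  move=> wz; have h1 := normc_Im (w - z); have h2 := normcD (w - z) z.
  rewrite subrK in h2; rewrite Im_addc Im_oppc ler_norml in h1.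
  by split; lra.
have [||||w wz wE] := @complex_fixed_point R (fun w => z + h w) z r (1 / 4).
- by apply/andP; split; lra.
- exact: r0.
- move=> w /deep dw; rewrite addrC addKr; exact: recip_cauchy_near.
- move=> w w' /deep dw /deep dw'.
  by rewrite opprD addrACA subrr add0r; exact: h_lipschitz.
exists w => //; split; first exact: deep.
by move: wE; rewrite /h addrA => /eqP; rewrite subr_eq addrC => /eqP/addrI ->.
Qed.

End cauchy_inverse.

(** * The limit measure as a free additive convolution *)

Section limit_transform.
Context {R : realType}.

Lemma ccvg_normc_sq (T : Type) (F : set_system T) (f : T -> R[i]) (l : R[i]) :
  Filter F -> normc (f x - l) ^+ 2 @[x --> F] --> (0 : R) -> ccvg F f l.
Proof.
move=> FF f0.
have h : normc (f x - l) @[x --> F] --> (0 : R).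
  have := cvg_comp _ _ f0 (@sqrt_continuous R 0); rewrite sqrtr0.
  apply: cvg_trans; apply: near_eq_cvg; apply: nearW => x /=.
  by rewrite sqrtr_sqr ger0_norm// normc_ge0.
have sub (p : R[i] -> R) : (forall u v, p (u - v) = p u - p v) ->
    (forall u, `|p u| <= normc u) -> p (f x) @[x --> F] --> p l.
  move=> pB pn; apply/cvgrPdist_le => e e0.
  move/cvgrPdist_le : h => /(_ e e0); apply: filterS => x.
  rewrite sub0r normrN ger0_norm ?normc_ge0// => fe.
  by rewrite distrC -pB (le_trans (pn _)).
by split; apply: sub => [u v|u]; rewrite ?ReImE//; [exact: normc_Re|exact: normc_Im].
Qed.

(** Above height 1 + t a characteristic descends too slowly to come within
    distance 1 of the real line before time t. *)
Lemma Im_characteristic (P : probR R) (w : R[i]) (s t : R) : 0 <= s <= t ->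
  1 + t <= Im w -> 1 <= Im (w + s%:C * cauchy_transform P w).
Proof.
move=> /andP[s0 st] tw; have w0 : 0 < Im w by lra.
have gw := normc_cauchy_transform P w0; have gi := normc_Im (cauchy_transform P w).
have iw : (Im w)^-1 <= 1 by rewrite invf_le1//; lra.
rewrite Im_addc Im_mulrc.
have : `|Im (cauchy_transform P w)| <= 1 by lra.
by rewrite ler_norml => /andP[h1 h2]; nra.
Qed.

Lemma weakly_cvg_cauchy (F : set_system nat) (P_ : nat -> probR R) (P : probR R) z :
  Filter F -> 0 < Im z ->
  (forall f : R -> R, continuous f -> (exists M, forall x, `|f x| <= M) ->
    (\int[P_ n]_x f x)%R @[n --> F] --> (\int[P]_x f x)%R) ->
  ccvg F (fun n => cauchy_transform (P_ n) z) (cauchy_transform P z).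
Proof.
move=> FF z0 PP; have cf := resolvent_continuous z0.
have [M fM] := resolvent_bounded z0.
split; apply: PP.
- exact: ccontinuous_Re cf.
- by exists M => x; apply: le_trans (fM x); exact: normc_Re.
- exact: ccontinuous_Im cf.
- by exists M => x; apply: le_trans (fM x); exact: normc_Im.
Qed.

(** In the limit the transform is constant along the characteristics of the
    inviscid Burgers equation, which start at w with slope G w. *)
Lemma flow_cauchy_cvg (mu : probR R) (x : forall n : nat, 'rV[R]_n.+1)
    (phi : forall n : nat, R -> 'rV[R]_n.+1) (t : R) (w : R[i]) :
  weakly_cvg (fun n => empirical ((Num.sqrt n.+1%:R)^-1 *: x n)) mu ->
  (forall n, is_flow (x n) (phi n)) -> 0 <= t -> 1 + t <= Im w ->
  ccvg \oo (fun n => cauchy_transform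
      (empirical ((Num.sqrt n.+1%:R)^-1 *: phi n t))
      (w + t%:C * cauchy_transform mu w)) (cauchy_transform mu w).
Proof.
move=> hmu hphi t0 tw; have w0 : 0 < Im w by lra.
set g := cauchy_transform mu w.
have bound n : normc (cauchy_transform
      (empirical ((Num.sqrt n.+1%:R)^-1 *: phi n t)) (w + t%:C * g) - g) ^+ 2 <=
    expR (3 * t) * (normc (cauchy_transform
      (empirical ((Num.sqrt n.+1%:R)^-1 *: x n)) w - g) ^+ 2 + n.+1%:R^-1 ^+ 2 * t).
  have := @characteristic_bound R n (x n) (phi n) (hphi n) w g 1 t ltr01 t0.
  have [_ _ -> _] := hphi n; rewrite !invr1 !expr1n !mulr1.
  rewrite (_ : 2 + 1 = 3); last by ring.
  by apply => s st; exact: (Im_characteristic mu st tw).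
apply: ccvg_normc_sq.
have c0 : normc (cauchy_transform
    (empirical ((Num.sqrt n.+1%:R)^-1 *: x n)) w - g) ^+ 2 @[n --> \oo] --> (0 : R).
  rewrite [X in _ --> X](_ : _ = normc (g - g) ^+ 2); last first.
    by rewrite subrr normc0 expr0n.
  apply: cvg_normc_sq; apply: ccvgB; last exact: ccvg_cst.
  exact: weakly_cvg_cauchy w0 hmu.
have c1 : (n.+1%:R^-1 ^+ 2 * t : R) @[n --> \oo] --> (0 : R).
  rewrite -[X in _ --> X](mul0r t); apply: cvgM; last exact: cvg_cst.
  have h := @cvg_harmonic R.
  by rewrite -[X in _ --> X](mul0r 0); exact: (cvgM h h).
have c2 : expR (3 * t) * (normc (cauchy_transform
      (empirical ((Num.sqrt n.+1%:R)^-1 *: x n)) w - g) ^+ 2 + n.+1%:R^-1 ^+ 2 * t)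
    @[n --> \oo] --> (0 : R).
  rewrite -[X in _ --> X](mulr0 (expR (3 * t))); apply: cvgM; first exact: cvg_cst.
  by rewrite -[X in _ --> X]addr0; exact: cvgD.
apply: (squeeze_cvgr _ (cvg_cst 0) c2); apply: nearW => n.
by rewrite sqr_ge0 bound.
Qed.

(** The Poisson kernel at distance b from the real line exceeds one half of its
    peak only within distance b: the Cauchy transform at one point controls the
    mass outside a compact interval. *)
Lemma cauchy_tight (P : probR R) (z : R[i]) (A : R) : 0 < Im z ->
  `|Re z| + Im z <= A ->
  - 2 * Im z * Im (cauchy_transform P z) - 1 <= distfun P A - distfun P (- A).
Proof.
move=> z0 zA; have A0 : - A <= A by have := normr_ge0 (Re z); lra.
have fi := (resolvent_integrable P z0).2.
have ci (k : R) : P.-integrable setT (EFin \o cst k).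
  apply: bounded_continuous_integrable; first by move=> x; exact: cvg_cst.
  by exists `|k|.
have fi' : P.-integrable setT
    (EFin \o (fun x : R => - 2 * Im z * Im (z - x%:C)^-1)).
  exact: (integrableZl measurableT (- 2 * Im z) fi).
have -> : - 2 * Im z * Im (cauchy_transform P z) - 1 =
    \int[P]_x (- 2 * Im z * Im (z - x%:C)^-1 - 1).
  rewrite RintegralB//; last exact: ci.
  by rewrite RintegralZl// Rintegral_cst//= probability_setT/= mulr1.
have -> : distfun P A - distfun P (- A) = \int[P]_x (\1_(`]- A, A]%classic) x).
  by rewrite -distfun_itv// /Rintegral integral_indic// setIT.
apply: le_Rintegral => //.
- exact: (integrableB measurableT fi' (ci 1)).
- exact: integrable_indic.
move=> x _; rewrite indicE mem_setE in_itv/= Im_invc !ReImE oppr0 addr0.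
move: (Re z) (Im z) z0 zA => a b b0 abA.
have D0 : 0 < (a + - x) ^+ 2 + b ^+ 2 by rewrite ltr_wpDl ?sqr_ge0// exprn_gt0.
have -> : - 2 * b * (- b / ((a + - x) ^+ 2 + b ^+ 2)) - 1 =
    (b ^+ 2 - (a - x) ^+ 2) / ((a + - x) ^+ 2 + b ^+ 2) by field; rewrite gt_eqF.
case: (boolP (- A < x <= A)) => /= [_|].
  by rewrite ler_pdivrMr// mul1r; have := sqr_ge0 (a - x); lra.
rewrite negb_and -leNgt -ltNge ler_pdivrMr// mul0r => h.
have : b <= `|a - x|.
  have := ler_norm a; have := ler_norm (- a); rewrite normrN => h1 h2.
  case/orP: h => h; first by rewrite ger0_norm; lra.
  by rewrite ler0_norm; lra.
by rewrite -(@ler_pXn2r _ 2)// ?nnegrE ?(ltW b0)// real_normK ?num_real//; lra.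
Qed.

End limit_transform.

Section imaginary_axis.
Context {R : realType}.

Lemma normc_imag (y : R) : 0 < y -> normc (0 +i* y) = y.
Proof. by move=> y0; rewrite normc_sqrt/= expr0n/= add0r sqrtr_sqr gtr0_norm. Qed.

Lemma inv_imag (y : R) : y != 0 -> (0 +i* y)^-1 = 0 +i* (- y^-1).
Proof.
move=> y0; apply: complex_ext; rewrite ?Re_invc ?Im_invc/= ?mul0r//.
by field.
Qed.

Lemma inv_imag_lipschitz (t y d : R) : 0 <= t -> 1 <= y -> 0 < d ->
  normc (t%:C / (0 +i* (y + d)) - t%:C / (0 +i* y)) <= t * d.
Proof.
move=> t0 y1 d0; have y0 : 0 < y by lra.
have yd0 : 0 < y + d by lra.
rewrite -mulrBr normcM normcr ger0_norm// ler_wpM2l//.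
rewrite !inv_imag ?gt_eqF//.
have -> : (0 +i* (- (y + d)^-1)) - (0 +i* (- y^-1)) = 0 +i* (d / (y * (y + d))).
  apply: complex_ext; rewrite !ReImE/=; first exact: subrr.
  by field; rewrite !gt_eqF.
have yy : 0 < y * (y + d) by rewrite mulr_gt0.
rewrite normc_imag ?divr_gt0// ler_pdivrMr// ler_peMr ?(ltW d0)//.
by rewrite mulr_ege1//; lra.
Qed.

(** With Re z bounded, |v - z|^2 - (Im z)^2 is at most affine in Im z with the
    negative slope - 2 Im v: discs tangent to the real line whose centers rise
    within a vertical strip exhaust the half plane. *)
Lemma half_plane_disc (v z : R[i]) (r : R) : 0 < Im v -> `|Re z| <= r ->
  ((`|Re v| + r) ^+ 2 + Im v ^+ 2) / (2 * Im v) < Im z -> normc (v - z) < Im z.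
Proof.
move=> v0 zr; rewrite ltr_pdivrMr ?mulr_gt0// => h.
have r0 : 0 <= r by exact: le_trans zr.
have z0 : 0 < Im z.
  have : 0 < Im z * (2 * Im v) by apply: le_lt_trans h; rewrite addr_ge0// sqr_ge0.
  by rewrite pmulr_lgt0// mulr_gt0.
rewrite -(@ltr_pXn2r _ 2)// ?nnegrE ?normc_ge0 ?(ltW z0)//.
rewrite normc_sq !ReImE.
have : (Re v - Re z) ^+ 2 <= (`|Re v| + r) ^+ 2.
  rewrite -[leLHS]real_normK ?num_real// lerXn2r ?nnegrE ?addr_ge0//.
  by rewrite (le_trans (ler_normB _ _))// lerD.
by rewrite (sqrrB (Im v)); lra.
Qed.

End imaginary_axis.

Section free_convolution.
Context {R : realType} (mu rho : probR R) (t : R).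
Hypothesis mu1 : mu.-integrable setT (fun x : R => x%:E).
Hypothesis t0 : 0 <= t.
Hypothesis rhoE : forall w, 1 + t <= Im w ->
  cauchy_transform rho (w + t%:C * cauchy_transform mu w) = cauchy_transform mu w.

Let m1 := \int[mu]_x `|x|.
Let r := 5 * (m1 + 1).
Let L := 100 * (m1 + 1).
Let m1_ge0 : 0 <= m1. Proof. exact: Rintegral_ge0. Qed.

Let bounded_asymptotic (a b C : R) (f : R[i] -> R[i]) : 0 <= C ->
  (forall z, stolz_cone a b z -> normc (f z) <= C) ->
  forall e : R, 0 < e -> exists M : R, forall z,
     stolz_cone a b z -> M%:C < `|z| -> `|f z| <= e%:C * `|z|.
Proof.
move=> C0 fC e e0; exists (C / e) => z zab.
rewrite -!normc_norm ltcR -rmorphM/= lecR ltr_pdivrMr// mulrC => /ltW.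
exact/le_trans/fC.
Qed.

(** Constancy along the characteristics, read at the point w where the reciprocal
    transform of mu equals z, says that the inverse of the reciprocal transform
    of rho at z is w + t / z: the Voiculescu transforms add up. *)
Lemma characteristics_free_add_conv :
  is_free_add_conv (semicircle (2 * Num.sqrt t)) mu rho.
Proof.
have t_ge0 := t0; have r0 : 0 <= r by rewrite mulr_ge0// addr_ge0.
have Lr : L = 20 * r by rewrite /L /r; ring.
have L0 : 0 <= L by rewrite Lr mulr_ge0.
pose b := 2 * L + t + 1.
have b0 : 0 < b by rewrite ltr_wpDl// addr_ge0// mulr_ge0.
have bE : b = 40 * r + t + 1 by rewrite /b Lr; ring.
have cone z : stolz_cone 1 b z -> normc z <= 2 * Im z /\ b < Im z.
  move=> [z1 z2]; split => //; have := normc_ReIm z.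
  by rewrite [`|Im z|]ger0_norm; lra.
have /choice[W WP] : forall z, exists w, stolz_cone 1 b z ->
    normc (w - z) <= r /\ deep_cone mu w /\ (cauchy_transform mu w)^-1 = z.
  move=> z; have [zc|nz] := pselect (stolz_cone 1 b z); last by exists 0.
  have [z1 z2] := cone z zc.
  have [|w wz wE] := recip_cauchy_surjective mu1 z1.
    by rewrite -/m1 -/L; apply: le_trans (ltW z2); rewrite /b -addrA lerDl addr_ge0.
  by exists w.
have tz z : stolz_cone 1 b z -> normc (t%:C / z) <= t.
  move=> /cone[_ bz]; rewrite normcM normcr normcV ger0_norm//.
  have : 1 <= normc z.
    have := normc_Im z; rewrite bE in bz.
    by rewrite ger0_norm; lra.
  by move=> z1; rewrite ler_piMr// invf_le1//; lra.
have WI z : stolz_cone 1 b z -> 1 + t <= Im (W z).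
  move=> zc; have [_ bz] := cone _ zc; have [Wr _] := WP z zc.
  have := normc_Im (W z - z); rewrite Im_addc Im_oppc ler_norml.
  by rewrite bE in bz; lra.
exists 1, b; split => //; exists (fun z => t%:C / z), (fun z => W z - z); split.
- split; last exact: bounded_asymptotic tz.
  move=> z zc; have [_ bz] := cone _ zc.
  have I0 : 0 < Im (z + t%:C / z).
    have := tz z zc; have := normc_Im (t%:C / z); rewrite Im_addc ler_norml.
    by rewrite bE in bz; lra.
  split => //; rewrite /recip_cauchy semicircle_cauchy ?invrK//.
  have : 1 + t <= normc z.
    by have := normc_Im z; rewrite ger0_norm; rewrite bE in bz; lra.
  by move=> z1; rewrite expr2; nra.
- split; last by apply: bounded_asymptotic r0 _ => z /WP[].
  move=> z zc; rewrite addrC subrK; have [_ [dW WE]] := WP z zc.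
  by split => //; have := WI z zc; lra.
- split; last first.
    apply: (@bounded_asymptotic _ _ (t + r)); first exact: addr_ge0.
    move=> z zc; rewrite (le_trans (normcD _ _))// lerD ?tz//.
    by have [] := WP z zc.
  move=> z zc; have [_ [dW WE]] := WP z zc; have wI := WI z zc.
  have gE : cauchy_transform mu (W z) = z^-1 by rewrite -[in RHS]WE invrK.
  have -> : z + (t%:C / z + (W z - z)) = W z + t%:C * cauchy_transform mu (W z).
    by rewrite gE; ring.
  split; last by rewrite /recip_cauchy rhoE// gE invrK.
  apply: lt_le_trans (@Im_characteristic _ mu (W z) t t _ wI) => //.
  by rewrite t0 lexx.
Qed.

(** The first Voiculescu transform is forced to be t / z by the quadratic
    equation of the semicircle law; so, at the points z of the imaginary axis,
    the sum of the two transforms leads to a point w + t / z, where w is the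
    value at z of an inverse of the reciprocal Cauchy transform of mu. *)
Lemma free_add_conv_imag_axis (rho' : probR R) :
  is_free_add_conv (semicircle (2 * Num.sqrt t)) mu rho' ->
  exists (Y : R) (W : R -> R[i]), 1 <= Y /\ forall y, Y < y ->
    [/\ deep_cone mu (W y), 1 + t <= Im (W y),
       (cauchy_transform mu (W y))^-1 = 0 +i* y,
       0 < Im (W y + t%:C / (0 +i* y)) &
       cauchy_transform rho' (W y + t%:C / (0 +i* y)) = (0 +i* y)^-1].
Proof.
move=> [a [b [a0 b0 [phi [psi [[phiE _] [psiE psiA] [sumE _]]]]]]].
have t_ge0 := t0; have L0 : 0 <= L by rewrite mulr_ge0// addr_ge0.
have e0 : 0 < (1 / 4 : R) by lra.
have [M psiM] := psiA _ e0.
pose Y := `|M| + b + 2 * L + 2 * t + 2.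
have M0 := normr_ge0 M; have M1 := ler_norm M.
have [Y1 YM Yb YL Yt] : [/\ 1 <= Y, M <= Y, b <= Y, 2 * L <= Y & 2 + 2 * t <= Y].
  by rewrite /Y; split; lra.
exists Y, (fun y => (0 +i* y) + psi (0 +i* y)); split => // y Yy.
clearbody Y; set z : R[i] := 0 +i* y.
have y0 : 0 < y by lra.
have nz : normc z = y by exact: normc_imag.
have zc : stolz_cone a b z by split; rewrite /= ?normr0 ?mulr_gt0//; lra.
have zn0 : z != 0 by rewrite Im_neq0.
have psi4 : normc (psi z) <= y / 4.
  have := psiM _ zc; rewrite -!normc_norm ltcR nz -rmorphM lecR.
  by rewrite mul1r mulrC; apply; lra.
have w34 : 3 / 4 * y <= Im (z + psi z).
  have := normc_Im (psi z); rewrite ler_norml Im_addc => /andP[h _].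
  by rewrite [Im z]/=; lra.
have [_ wE] := psiE _ zc.
have phiF : phi z = t%:C / z.
  have [I0 E] := phiE _ zc.
  have gE : cauchy_transform (semicircle (2 * Num.sqrt t)) (z + phi z) = z^-1.
    by rewrite -[in RHS]E /recip_cauchy invrK.
  have := semicircle_quadratic t0 I0; rewrite /= gE => Q.
  apply/eqP; rewrite -subr_eq0; apply/eqP.
  have : t%:C * z^-1 ^+ 2 - (z + phi z) * z^-1 + 1 = - (phi z - t%:C / z) / z.
    by field.
  rewrite Q => /esym/eqP; rewrite mulf_eq0 invr_eq0 (negbTE zn0) orbF oppr_eq0.
  by move/eqP.
have [I0 E] := sumE _ zc.
have zE : z + (phi z + psi z) = z + psi z + t%:C / z by rewrite phiF; ring.
rewrite zE in I0 E; split => //.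
- split; last by rewrite -/m1 -/L; lra.
  by rewrite (le_trans (normcD _ _))// nz; lra.
- by lra.
- by rewrite -[in RHS]E /recip_cauchy invrK.
Qed.

(** Both transforms agree at the points found on the imaginary axis. These
    points accumulate at each of them, so the transforms agree on the discs that
    they span with the real line, and the points tend to infinity within a
    vertical strip, so the discs exhaust the upper half plane. *)
Lemma free_add_conv_unique (rho' : probR R) :
  is_free_add_conv (semicircle (2 * Num.sqrt t)) mu rho' ->
  forall z, 0 < Im z -> cauchy_transform rho' z = cauchy_transform rho z.
Proof.
move=> /free_add_conv_imag_axis[Y [W [Y1 WP]]] v v0.
have t_ge0 := t0; have r0 : 0 <= r by rewrite mulr_ge0// addr_ge0.
pose zeta y := W y + t%:C / (0 +i* y).
have zetaE y : Y < y -> cauchy_transform rho (zeta y) = (0 +i* y)^-1.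
  move=> /WP[_ Wt WE _ _].
  have gE : cauchy_transform mu (W y) = (0 +i* y)^-1 by rewrite -WE invrK.
  by rewrite /zeta -gE rhoE.
pose B := ((`|Re v| + r) ^+ 2 + Im v ^+ 2) / (2 * Im v).
have B0 : 0 <= B by rewrite divr_ge0 ?addr_ge0 ?sqr_ge0// mulr_ge0// ltW.
have [y [Yy By]] : exists y, Y < y /\ B + t + r < y.
  by exists (Y + B + t + r + 1); split; lra.
have y1 : 1 <= y by lra.
have [dW _ WE I0 _] := WP y Yy.
rewrite -[v](subrK (zeta y)) addrC; apply: cauchy_transform_identity => //.
  move=> e e0; pose d := e / (2 * (2 + t)).
  have t2 : 0 < 2 * (2 + t) by rewrite mulr_gt0//; lra.
  have d0 : 0 < d by rewrite divr_gt0.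
  have dE : 2 * d + t * d = e / 2 by rewrite /d; field; rewrite gt_eqF//; lra.
  clearbody d.
  have Yd : Y < y + d by lra.
  have [dW' _ WE' _ rE'] := WP _ Yd.
  exists (zeta (y + d) - zeta y); last by rewrite addrC subrK rE' zetaE.
  split.
    apply/eqP => /subr0_eq zz; have := zetaE _ Yd; rewrite zz zetaE//.
    by move=> /invr_inj[] yy; move: d0; rewrite -(ltrDl y) -yy ltxx.
  rewrite /zeta opprD addrACA (le_lt_trans (normcD _ _))//.
  have h1 : normc (W (y + d) - W y) <= 2 * d.
    apply: le_trans (recip_cauchy_lipschitz mu1 dW' dW) _.
    rewrite WE WE' (_ : _ - _ = 0 +i* d) ?normc_imag//.
    by apply: complex_ext; rewrite !ReImE/=; [exact: subrr|rewrite addrAC subrr add0r].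
  have h2 := inv_imag_lipschitz t0 y1 d0.
  by rewrite (le_lt_trans (lerD h1 h2))// dE; lra.
have near_y : normc (W y - (0 +i* y)) <= r.
  by rewrite -WE; exact: recip_cauchy_near.
have ty : t / y <= t by rewrite ler_piMr// invf_le1//; lra.
have y_neq0 : y != 0 by rewrite gt_eqF//; lra.
apply: (@half_plane_disc _ _ _ r).
- by [].
- rewrite /zeta inv_imag// Re_addc Re_mulrc/= mulr0 addr0.
  by have := le_trans (normc_Re _) near_y; rewrite !ReImE/= subr0.
- rewrite -/B /zeta inv_imag// Im_addc Im_mulrc/= mulrN.
  have := le_trans (normc_Im _) near_y; rewrite !ReImE/= ler_norml => /andP[h _].
  by lra.
Qed.

End free_convolution.

(** Convergence of the Cauchy transforms at one point high on the imaginary axis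
    already bounds the mass that escapes to infinity. *)
Lemma characteristics_tight (R : realType) (mu : probR R) (P_ : nat -> probR R)
    (t : R) : mu.-integrable setT (fun x : R => x%:E) -> 0 <= t ->
  (forall w, 1 + t <= Im w -> ccvg \oo
    (fun n => cauchy_transform (P_ n) (w + t%:C * cauchy_transform mu w))
    (cauchy_transform mu w)) ->
  forall e : R, 0 < e -> exists2 A : R, 0 < A &
    \forall n \near \oo, 1 - e <= distfun (P_ n) A - distfun (P_ n) (- A).
Proof.
move=> mu1 t0 transform e e0; set m1 := \int[mu]_x `|x|.
have m1_ge0 : 0 <= m1 by exact: Rintegral_ge0.
pose y := 4 * (m1 + t) / e + 1 + t.
have ye : 4 * (m1 + t) / e <= y by rewrite /y; lra.
have y1 : 1 + t <= y.
  by rewrite /y -addrA lerDr divr_ge0// ?(ltW e0)// mulr_ge0// addr_ge0.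
have y0 : 0 < y by lra.
pose w : R[i] := 0 +i* y; set g := cauchy_transform mu w.
pose zt := w + t%:C * g.
have zt1 : 1 <= Im zt by apply: (@Im_characteristic _ _ _ _ t) => //; rewrite t0 lexx.
exists (`|Re zt| + Im zt); first by rewrite ltr_wpDl//; lra.
have near_i (u : R[i]) : normc (w * u - 1) <= (Im w)^-1 * m1 ->
    normc u <= (Im w)^-1 -> 1 - e / 2 <= - 2 * Im (w + t%:C * u) * Im u - 1.
  move=> h /(le_trans (normc_Im u)); have := le_trans (normc_Re _) h.
  rewrite Im_addc Im_mulrc !ReImE /= mul0r sub0r ler_norml.
  move: (Im u) => b /andP[h1 _] h2.
  have ty : t * b ^+ 2 <= y^-1 * t.
    rewrite mulrC ler_wpM2r// -real_normK ?num_real//.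
    rewrite (@le_trans _ _ (y^-1 ^+ 2))//.
      by rewrite lerXn2r ?nnegrE// invr_ge0 ltW.
    by rewrite expr2 ler_piMr ?invr_ge0 ?(ltW y0)// invf_le1//; lra.
  have : y^-1 * (m1 + t) <= e / 4.
    by rewrite mulrC ler_pdivrMr// mulrC; move: ye; rewrite ler_pdivrMr//; lra.
  by rewrite mulrDr; move: ty; rewrite expr2; lra.
have near_g : 1 - e / 2 <= - 2 * Im zt * Im g - 1.
  by apply: near_i; [exact: cauchy_near1|exact: normc_cauchy_transform].
have := (transform w y1).2; rewrite -/g -/zt => cg.
have cl : - 2 * Im zt * Im (cauchy_transform (P_ n) zt) - 1 @[n --> \oo] -->
    - 2 * Im zt * Im g - 1.
  by apply: cvgB; [apply: cvgM => //; exact: cvg_cst|exact: cvg_cst].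
have lt1 : 1 - e < - 2 * Im zt * Im g - 1 by lra.
have near_n : \forall n \near \oo,
    1 - e < - 2 * Im zt * Im (cauchy_transform (P_ n) zt) - 1.
  by apply: (cvgr_gt _ cl).
apply: filterS near_n => n hn.
by apply: (le_trans (ltW hn)); apply: cauchy_tight => //; lra.
Qed.

Theorem theorem2p10 (R : realType) (mu : probR R)
    (c : R) (hc : 0 < c)
    (hint : forall l : nat, mu.-integrable setT (fun x : R => (x ^+ l)%:E))
    (hmom : forall l : nat, `| \int[mu]_x (x ^+ l) | <= (c * l%:R) ^+ l)
    (x : forall n : nat, 'rV[R]_n.+1)
    (hx : forall n : nat, weyl_chamber R n.+1 (x n))
    (hmu0 : weakly_cvg
       (fun n => empirical ((Num.sqrt n.+1%:R)^-1 *: x n)) mu)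
    (phi : forall n : nat, R -> 'rV[R]_n.+1)
    (hphi : forall n : nat, is_flow (x n) (phi n)) :
  forall t : R, 0 <= t ->
    weakly_cvg (fun n => empirical ((Num.sqrt n.+1%:R)^-1 *: phi n t))
      (free_add_conv (semicircle (2 * Num.sqrt t)) mu).
Proof.
move=> t t0 f cf bf.
have mu1 : mu.-integrable setT (fun x : R => x%:E).
  by have := hint 1%N; under eq_fun do rewrite expr1.
set P_ := fun n => empirical ((Num.sqrt n.+1%:R)^-1 *: phi n t) : probR R.
have transform w : 1 + t <= Im w -> ccvg \oo
    (fun n => cauchy_transform (P_ n) (w + t%:C * cauchy_transform mu w))
    (cauchy_transform mu w).
  by move=> tw; exact: flow_cauchy_cvg hmu0 hphi t0 tw.
have tight := characteristics_tight mu1 t0 transform.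
apply: cvg_ultra => U UU ooU.
have PU : ProperFilter U by exact: ultra_proper.
have FU : Filter U by exact: filter_filter.
have tightU (e : R) : 0 < e -> exists2 A : R, 0 < A &
    \forall n \near U, 1 - e <= distfun (P_ n) A - distfun (P_ n) (- A).
  by move=> /tight[A A0 nA]; exists A => //; exact: ooU.
have [rho rhoP] := ultra_prokhorov UU tightU.
have rhoE w : 1 + t <= Im w ->
    cauchy_transform rho (w + t%:C * cauchy_transform mu w) = cauchy_transform mu w.
  move=> tw; set zt := w + _.
  have zt0 : 0 < Im zt.
    by apply: lt_le_trans (@Im_characteristic _ mu w t t _ tw); rewrite ?t0 ?lexx.
  have [r1 r2] := weakly_cvg_cauchy FU zt0 rhoP.
  have [g1 g2] := transform w tw.
  apply: complex_ext.
    apply: (@cvg_unique _ (@Rhausdorff R) _ _ _ _ r1).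
    by apply: cvg_trans g1; exact: cvg_app.
  apply: (@cvg_unique _ (@Rhausdorff R) _ _ _ _ r2).
  by apply: cvg_trans g2; exact: cvg_app.
have conv : is_free_add_conv (semicircle (2 * Num.sqrt t)) mu
    (free_add_conv (semicircle (2 * Num.sqrt t)) mu).
  apply: getPex; exists rho; exact: characteristics_free_add_conv.
have dE := distfun_cauchy_transform (free_add_conv_unique mu1 t0 rhoE conv).
have -> : \int[free_add_conv (semicircle (2 * Num.sqrt t)) mu]_x f x = \int[rho]_x f x.
  rewrite /Rintegral; congr fine; apply: eq_measure_integral => A mA _.
  exact: distfun_inj.
exact: rhoP.
Qed.
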